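(* Let $(M,g)$ be a compact Riemannian manifold, let $G$ be a Kaluza-Klein metric on $TM$ with functions $A\equiv 1$, $B$, $C$, and let $\sigma:(M,g)\to(TM,G)$ be a harmonic section, i.e. $\tau^v(\sigma)=0$. Suppose that, with $B,B',C'$ evaluated at $|\sigma|^2$, $$2B'+|\sigma|^2C'\ge 0\quad\text{and}\quad -B+|\sigma|^2B'+|\sigma|^4C'\le 0$$ on $M$. Then the norm of $\sigma$ is constant. If moreover $B+|\sigma|^2B'$ does not vanish, then $\sigma$ must be parallel.
   Context: Let $(M,g)$ be a Riemannian manifold with Levi-Civita connection $\nabla$. At $(p,e)\in TM$ the space $T_{(p,e)}TM$ splits into the vertical space (kernel of $d\pi$, $\pi:TM\to M$ the projection) and the horizontal space defined by $\nabla$; each $X\in T_pM$ has a horizontal lift $X^h$ and a vertical lift $X^v$. A Kaluza-Klein metric on $TM$ is a Riemannian metric $G$ such that at $(p,e)$ $$G(X^h,Y^h)=A(|e|^2)g(X,Y),\quad G(X^h,Y^v)=0,\quad G(X^v,Y^v)=B(|e|^2)g(X,Y)+C(|e|^2)g(X,e)g(Y,e),$$ where $A,B,C$ are real $C^2$ functions on $[0,\infty)$, $A>0$, and $B,C$ are such that $G$ is positive definite. Primes denote derivatives of these functions of one variable. A vector field $\sigma$ on $M$ is viewed as a map $\sigma:(M,g)\to(TM,G)$. Its tension field $\tau(\sigma)=\operatorname{trace}\nabla d\sigma$ (computed with the Levi-Civita connections of $g$ and $G$) is decomposed as $\tau(\sigma)=[\tau^h(\sigma)]^h+[\tau^v(\sigma)]^v$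 with $\tau^h(\sigma),\tau^v(\sigma)$ vector fields on $M$. $\sigma$ is a harmonic section if $\tau^v(\sigma)=0$ (equivalently, it is critical for the energy with respect to variations through vector fields).
   Formalization: The compact manifold M is assumed connected; otherwise the norm need only be constant on each component (e.g. parallel fields of different norms on two disjoint circles). *)

(* Defs.v *)
From HB Require Import structures.
From mathcomp Require Import all_boot all_order all_algebra.
From mathcomp Require Import all_classical reals topology normedtype derive.

Set Implicit Arguments.
Unset Strict Implicit.
Unset Printing Implicit Defensive.
Import Order.TTheory GRing.Theory Num.Theory.
Import numFieldNormedType.Exports.
Local Open Scope classical_set_scope.
Local Open Scope ring_scope.

(** * Functions of class C^k on open sets of R^n *)

Section Calculus.
Variables (R : realType) (n : nat) (W : normedModType R).
Implicit Types (f : 'rV[R]_n -> W) (U : set 'rV[R]_n).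

Definition iter_derive f (s : seq 'rV[R]_n) : 'rV[R]_n -> W :=
  foldr (fun v h => 'D_v h) f s.

Definition Ck_on (k : nat) U f : Prop :=
  (forall s x, (size s < k)%N -> U x -> differentiable (iter_derive f s) x) /\
  (forall s x, size s = k -> U x -> {for x, continuous (iter_derive f s)}).

Definition smooth_on U f : Prop := forall k, Ck_on k U f.

Definition partial (i : 'I_n) f : 'rV[R]_n -> W := 'D_(delta_mx 0 i) f.

End Calculus.

(** * Functions of class C^2 on the closed half-line [0, +oo[

    The difference quotients only involve points of the half-line, so that
    [hderive f 0] is the right derivative and the values of [f] at negative
    arguments are irrelevant. *)

Section HalfLine.
Variable R : realType.
Implicit Type f : R -> R.

Definition hquotient f (t : R) : set_system R :=
  (fun h => h^-1 * (f (t + h) - f t)) @ within [set h | 0 <= t + h] 0^'.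

Definition hderivable f (t : R) : Prop := cvg (hquotient f t).

Definition hderive f (t : R) : R := lim (hquotient f t).

Definition C2_halfline f : Prop :=
  [/\ forall t, 0 <= t -> hderivable f t,
      forall t, 0 <= t -> hderivable (hderive f) t &
      {within [set t | 0 <= t], continuous (hderive (hderive f))}].

End HalfLine.

(** * Smooth manifolds, by charts *)

Record charts (R : realType) (n : nat) (M : Type) := Charts {
  chart : Type;
  dom : chart -> set M;
  coord : chart -> M -> 'rV[R]_n }.

Section Manifolds.
Variables (R : realType) (n : nat) (M : Type) (D : charts R n M).

(* The function [F] on [M] read in the chart [i], i.e. [F \o (coord i)^-1];
   it is set to [0] outside of the image of the chart. *)
Definition read_in (W : normedModType R) (i : chart D) (F : M -> W)
    (x : 'rV[R]_n) : W :=
  xget 0 [set F p | p in [set p | dom i p /\ coord i p = x]].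

Definition overlap (i j : chart D) : set 'rV[R]_n :=
  coord i @` (dom i `&` dom j).

Definition transition (i j : chart D) : 'rV[R]_n -> 'rV[R]_n :=
  read_in i (coord j).

Definition smooth_atlas : Prop :=
  [/\ forall p, exists i : chart D, dom i p,
      forall (i : chart D) p q,
        dom i p -> dom i q -> coord i p = coord i q -> p = q,
      forall i j, open (overlap i j) &
      forall i j, smooth_on (overlap i j) (transition i j)].

(* A tangent vector at [foot] is the family of its components [tcomp i] in all
   the charts around [foot], related by the differentials of the transition
   maps. The components in the other charts carry no information; they are set
   to [0] so that equality of tangent vectors is Leibniz equality. *)
Record tangent := Tangent {
  foot : M;
  tcomp : chart D -> 'rV[R]_n;
  tcomp_out : forall i, ~ dom i foot -> tcomp i = 0;
  tcomp_transition : forall i j, dom i foot -> dom j foot ->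
    tcomp j = 'D_(tcomp i) (transition i j) (coord i foot) }.

End Manifolds.

Definition smooth_manifold (R : realType) (n : nat) (M : topologicalType)
    (D : charts R n M) : Prop :=
  [/\ smooth_atlas D, hausdorff_space M, @second_countable M,
      forall i : chart D, open (dom i) &
      (* each chart is a homeomorphism onto its image *)
      forall (i : chart D) (U : set M),
        U `<=` dom i -> (open U <-> open (coord i @` U))].

(* The tangent bundle with its induced charts (x, y). *)
Definition tangent_charts (R : realType) (n : nat) (M : Type)
    (D : charts R n M) : charts R (n + n) (tangent D) :=
  Charts (fun (i : chart D) (e : tangent D) => dom i (foot e))
         (fun (i : chart D) (e : tangent D) =>
            row_mx (coord i (foot e)) (tcomp e i)).

Definition smooth_map (R : realType) (m n : nat) (M N : Type)
    (D : charts R m M) (E : charts R n N) (f : M -> N) : Prop :=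
  forall (i : chart D) (a : chart E),
    let U := coord i @` (dom i `&` f @^-1` dom a) in
    open U /\ smooth_on U (read_in i (coord a \o f)).

Definition vector_field (R : realType) (n : nat) (M : Type)
    (D : charts R n M) (sigma : M -> tangent D) : Prop :=
  (forall p, foot (sigma p) = p) /\ smooth_map D (tangent_charts D) sigma.

(** * Riemannian metrics *)

Definition form (R : realType) (n : nat) (a : 'M[R]_n) (u v : 'rV[R]_n) : R :=
  (u *m a *m v^T) 0 0.

Section Metrics.
Variables (R : realType) (n : nat) (M : Type) (D : charts R n M).

(* A (0,2)-tensor field is given by its matrix of components in each chart. *)
Definition tensor2 := chart D -> M -> 'M[R]_n.

Definition riemannian_metric_of_class (k : nat) (g : tensor2) : Prop :=
  [/\ forall i p, dom i p -> (g i p)^T = g i p,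
      forall i p u, dom i p -> u != 0 -> 0 < form (g i p) u u,
      forall i j p u v, dom i p -> dom j p ->
        form (g i p) u v =
        form (g j p) ('D_u (transition i j) (coord i p))
                     ('D_v (transition i j) (coord i p)) &
      forall i, Ck_on k (coord i @` dom i) (read_in i (g i))].

Definition riemannian_metric (g : tensor2) : Prop :=
  forall k, riemannian_metric_of_class k g.

(* |e|^2 = g(e, e), computed in any chart around the foot of [e]. *)
Definition sqnorm (g : tensor2) (e : tangent D) : R :=
  xget 0 [set form (g i (foot e)) (tcomp e i) (tcomp e i)
         | i in [set i | dom i (foot e)]].

Definition tnorm (g : tensor2) (e : tangent D) : R := Num.sqrt (sqnorm g e).

End Metrics.

(** * Levi-Civita connection and tension field, in coordinates *)

Section LeviCivita.
Variables (R : realType) (n : nat) (h : 'rV[R]_n -> 'M[R]_n).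

(* Gamma^k_ij *)
Definition christoffel (x : 'rV[R]_n) (i j k : 'I_n) : R :=
  2^-1 * \sum_l invmx (h x) k l *
    (partial i (fun y => h y j l) x + partial j (fun y => h y i l) x
     - partial l (fun y => h y i j) x).

(* The vector with components \sum_ij Gamma^k_ij u^i v^j *)
Definition Gamma (x u v : 'rV[R]_n) : 'rV[R]_n :=
  \row_k \sum_i \sum_j christoffel x i j k * u 0 i * v 0 j.

End LeviCivita.

Section Tension.
Variables (R : realType) (m n : nat).

(* (nabla df)(d_i, d_j), for f : (R^m, g) -> (R^n, h) *)
Definition second_fundamental_form (g : 'rV[R]_m -> 'M[R]_m)
    (h : 'rV[R]_n -> 'M[R]_n) (f : 'rV[R]_m -> 'rV[R]_n)
    (x : 'rV[R]_m) (i j : 'I_m) : 'rV[R]_n :=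
  partial i (partial j f) x - \sum_k christoffel g x i j k *: partial k f x
  + Gamma h (f x) (partial i f x) (partial j f x).

Definition tension_coord (g : 'rV[R]_m -> 'M[R]_m) (h : 'rV[R]_n -> 'M[R]_n)
    (f : 'rV[R]_m -> 'rV[R]_n) (x : 'rV[R]_m) : 'rV[R]_n :=
  \sum_i \sum_j invmx (g x) i j *: second_fundamental_form g h f x i j.

(* Components in the chart [a] of [N] of the tension field at [p] of
   f : (M, g) -> (N, h), computed in the chart [i] of [M]. *)
Definition tension (M N : Type) (D : charts R m M) (E : charts R n N)
    (g : tensor2 D) (h : tensor2 E) (f : M -> N)
    (i : chart D) (a : chart E) (p : M) : 'rV[R]_n :=
  tension_coord (read_in i (g i)) (read_in a (h a))
    (read_in i (coord a \o f)) (coord i p).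

End Tension.

(** * Kaluza-Klein metrics and harmonic sections *)

Section KaluzaKlein.
Variables (R : realType) (n : nat) (M : Type) (D : charts R n M).
Variable g : tensor2 D.

Definition chart_Gamma (i : chart D) (p : M) (u v : 'rV[R]_n) : 'rV[R]_n :=
  Gamma (read_in i (g i)) (coord i p) u v.

(* Components of (nabla_u sigma)(p) in the chart [i]. *)
Definition covariant_derivative (sigma : M -> tangent D) (i : chart D) (p : M)
    (u : 'rV[R]_n) : 'rV[R]_n :=
  'D_u (read_in i (fun q => tcomp (sigma q) i)) (coord i p)
  + chart_Gamma i p u (tcomp (sigma p) i).

Definition parallel (sigma : M -> tangent D) : Prop :=
  forall (i : chart D) (p : M) (u : 'rV[R]_n),
    dom i p -> covariant_derivative sigma i p u = 0.

(* Components, in the induced chart of TM, of the lifts to T_e TM of the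
   vector with components [u] in the chart [i]. *)
Definition hlift (i : chart D) (e : tangent D) (u : 'rV[R]_n) : 'rV[R]_(n + n) :=
  row_mx u (- chart_Gamma i (foot e) u (tcomp e i)).

Definition vlift (u : 'rV[R]_n) : 'rV[R]_(n + n) := row_mx 0 u.

(* The fields w^h, w^v such that w = (w^h)^h + (w^v)^v for w in T_e TM. *)
Definition hpart (w : 'rV[R]_(n + n)) : 'rV[R]_n := lsubmx w.

Definition vpart (i : chart D) (e : tangent D) (w : 'rV[R]_(n + n)) : 'rV[R]_n :=
  rsubmx w + chart_Gamma i (foot e) (lsubmx w) (tcomp e i).

Lemma hpart_vpartE i e w : w = hlift i e (hpart w) + vlift (vpart i e w).
Proof.
by rewrite /hlift /vlift add_row_mx addr0 addrC addrK hsubmxK.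
Qed.

Definition kaluza_klein (A B C : R -> R) (G : tensor2 (tangent_charts D)) : Prop :=
  [/\ [/\ C2_halfline A, C2_halfline B & C2_halfline C],
      forall t, 0 <= t -> 0 < A t,
      riemannian_metric_of_class 2 G &
      forall (i : chart D) (e : tangent D) (u v : 'rV[R]_n), dom i (foot e) ->
        let s := sqnorm g e in
        let ge := form (g i (foot e)) in
        let y := tcomp e i in
        [/\ form (G i e) (hlift i e u) (hlift i e v) = A s * ge u v,
            form (G i e) (hlift i e u) (vlift v) = 0 &
            form (G i e) (vlift u) (vlift v)
              = B s * ge u v + C s * ge u y * ge v y]].

(* tau^v(sigma) = 0; the tension field is read in the chart of TM induced by
   the chart [i] of M. *)
Definition harmonic_section (G : tensor2 (tangent_charts D))
    (sigma : M -> tangent D) : Prop :=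
  forall (i : chart D) (p : M), dom i p ->
    vpart i (sigma p)
      (@tension R n (n + n) M (tangent D) D (tangent_charts D)
         g G sigma i i p) = 0.

End KaluzaKlein.

(* Main.v *)
Require Import Defs.
From mathcomp Require Import all_boot all_order all_algebra.
From mathcomp Require Import all_classical reals topology normedtype derive.
From mathcomp Require Import landau interval_inference ring lra.
Import Order.TTheory GRing.Theory Num.Theory.
Import numFieldNormedType.Exports.
Local Open Scope classical_set_scope.
Local Open Scope ring_scope.
Set Implicit Arguments.
Unset Strict Implicit.
Unset Printing Implicit Defensive.

(** With [s = |sigma|^2], pairing [tau^v(sigma) = 0] with [sigma] gives
    [(B + s C) Delta(s/2) = (B + s B') |nabla sigma|^2 - (2 B' + s C') |d(s/2)|^2].
    Since [|d(s/2)|^2 <= s |nabla sigma|^2], the two sign conditions make the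
    right-hand side nonnegative, and [B + s C > 0] because [G] is positive
    definite; so [s] is subharmonic, hence constant by Hopf's strong maximum
    principle on the compact connected [M]. The identity then reads
    [(B + s B') |nabla sigma|^2 = 0]. *)

(** The obstacle is the Levi-Civita connection of [G]: its Christoffel symbols involve derivatives
    of those of [g], that is, curvature. Pairing with the single vertical vector [V = (0, sigma)]
    avoids them. For [U = d sigma(w)] the Koszul formula gives [G(Gamma(U, U), V)] from
    [D_U G(U, V)] and [D_V G(U, U)] alone. The first comes from differentiating along the section
    the identity [G(U, V) = (B + s C) D_w s / 2]. The second comes from moving [sigma] to
    [(1 + t) sigma] inside its fibre, where the base point, [g] and its Christoffel symbols stay
    fixed; since [A = 1], the horizontal part of [G] stays fixed too. Traces are taken at one point,
    over a frame orthonormal there whose vectors have constant coordinates, so no frame field is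
    differentiated. The maximum principle is local, in a chart, for an operator whose coefficients
    are merely continuous; connectedness of [M] then spreads the maximum value. *)

Local Notation form := Defs.form.
Local Notation coord := Defs.coord.

(** * Directional derivatives *)

Section DirectionalDerivatives.
Variables (R : realType) (V : normedModType R).
Implicit Types x v : V.

Lemma is_derive_mul (f g : V -> R) x v df dg :
  is_derive x v f df -> is_derive x v g dg ->
  is_derive x v (fun y => f y * g y) (df * g x + f x * dg).
Proof.
move=> hf hg; apply: is_derive_eq.
rewrite addrC; congr (_ + _); exact: mulrC.
Qed.

Lemma is_derive_add (W : normedModType R) (f g : V -> W) x v df dg :
  is_derive x v f df -> is_derive x v g dg ->
  is_derive x v (fun y => f y + g y) (df + dg).
Proof. by move=> hf hg; apply: is_deriveD. Qed.

Lemma is_derive_sub (W : normedModType R) (f g : V -> W) x v df dg :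
  is_derive x v f df -> is_derive x v g dg ->
  is_derive x v (fun y => f y - g y) (df - dg).
Proof. by move=> hf hg; apply: is_deriveB. Qed.

Lemma is_derive_bigsum (W : normedModType R) n (f : 'I_n -> V -> W) x v df :
  (forall i, is_derive x v (f i) (df i)) ->
  is_derive x v (fun y => \sum_i f i y) (\sum_i df i).
Proof.
move=> hf; have := is_derive_sum hf; congr (is_derive _ _ _ _).
by apply/funext => y; rewrite fct_sumE.
Qed.

Lemma is_derive_mxP m n (M : V -> 'M[R]_(m, n)) x v dM :
  is_derive x v M dM <-> forall i j, is_derive x v (fun y => M y i j) (dM i j).
Proof.
split=> [[hM <-] i j|hM].
  split; first exact: (derivable_mxP _ _ _).1.
  by rewrite derive_mx // mxE.
have dx : derivable M x v by apply/derivable_mxP => i j; by case: (hM i j).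
split=> //; rewrite derive_mx //; apply/matrixP => i j; rewrite mxE.
by have [_ ->] := hM i j.
Qed.

Lemma is_derive_mulmx m n p (M : V -> 'M[R]_(m, n)) (N : V -> 'M[R]_(n, p))
    x v dM dN :
  is_derive x v M dM -> is_derive x v N dN ->
  is_derive x v (fun y => M y *m N y) (dM *m N x + M x *m dN).
Proof.
move=> /is_derive_mxP hM /is_derive_mxP hN; apply/is_derive_mxP => i k.
rewrite !mxE -big_split /=.
rewrite (_ : (fun y => _) = fun y => \sum_j M y i j * N y j k); last first.
  by apply/funext => y; rewrite mxE.
by apply: is_derive_bigsum => j; apply: is_derive_mul.
Qed.

Lemma is_derive_form n (g : V -> 'M[R]_n) (a b : V -> 'rV[R]_n) x v dg da db :
  is_derive x v g dg -> is_derive x v a da -> is_derive x v b db ->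
  is_derive x v (fun y => form (g y) (a y) (b y))
    (form dg (a x) (b x) + form (g x) da (b x) + form (g x) (a x) db).
Proof.
move=> hg ha hb.
have hbT : is_derive x v (fun y => (b y)^T) db^T.
  apply/is_derive_mxP => i j; rewrite mxE.
  rewrite (_ : (fun y => _) = fun y => b y j i); last first.
    by apply/funext => y; rewrite mxE.
  by move/is_derive_mxP : hb.
have /is_derive_mxP/(_ 0 0) := is_derive_mulmx (is_derive_mulmx ha hg) hbT.
congr (is_derive _ _ _ _); rewrite /form !mulmxDl !mxE /=.
by rewrite [X in X + _]addrC.
Qed.

Lemma is_derive_fst m n (f : V -> 'rV[R]_(m + n)) x v df :
  is_derive x v f df -> is_derive x v (fun y => lsubmx (f y)) (lsubmx df).
Proof.
move=> /is_derive_mxP hf; apply/is_derive_mxP => i j; rewrite mxE.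
by under eq_fun do rewrite mxE.
Qed.

Lemma is_derive_snd m n (f : V -> 'rV[R]_(m + n)) x v df :
  is_derive x v f df -> is_derive x v (fun y => rsubmx (f y)) (rsubmx df).
Proof.
move=> /is_derive_mxP hf; apply/is_derive_mxP => i j; rewrite mxE.
by under eq_fun do rewrite mxE.
Qed.

Lemma is_derive_diff (W : normedModType R) (f : V -> W) x v :
  differentiable f x -> is_derive x v f ('D_v f x).
Proof. by move=> /diff_derivable h; apply: derivableP. Qed.

Lemma derive_comp (W Z : normedModType R) (f : V -> W) (h : W -> Z) x v :
  differentiable f x -> differentiable h (f x) ->
  'D_v (h \o f) x = 'D_('D_v f x) h (f x).
Proof.
move=> df dh; rewrite !deriveE //; first by rewrite diff_comp.
exact: differentiable_comp.
Qed.

Lemma derive_lin (W : normedModType R) (f : V -> W) x (a : R) u v :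
  differentiable f x -> 'D_(a *: u + v) f x = a *: 'D_u f x + 'D_v f x.
Proof. by move=> df; rewrite !deriveE // linearP. Qed.

(** The two difference quotients are the same function of the increment. This reduces directional
    derivatives to one real variable. *)
Lemma is_derive_line (W : normedModType R) (f : V -> W) x v (t : R) df :
  is_derive (t *: v + x) v f df ->
  is_derive t 1 (fun u : R => f (u *: v + x)) df.
Proof.
move=> [h1 h2].
have e : (fun h : R => h^-1 *: (((fun u : R => f (u *: v + x)) \o shift t) (h *: 1)
     - f (t *: v + x)))
  = (fun h : R => h^-1 *: ((f \o shift (t *: v + x)) (h *: v) - f (t *: v + x))).
  apply/funext => h /=; congr (_ *: (f _ - _)).
  by rewrite [h *: 1]mulr1 scalerDl addrA.
by split; [rewrite /derivable e | rewrite /derive e].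
Qed.

End DirectionalDerivatives.

Section CoordinateDerivatives.
Variables (R : realType) (n : nat) (W : normedModType R).
Implicit Types (f : 'rV[R]_n -> W) (x v : 'rV[R]_n).

Lemma derive_partial f x v : differentiable f x ->
  'D_v f x = \sum_j v 0 j *: partial j f x.
Proof.
move=> df; rewrite deriveE // {1}[v]row_sum_delta linear_sum.
by apply: eq_bigr => j _; rewrite linearZ /partial deriveE.
Qed.

(** Differentiability near [x] makes the expansion of ['D_v f] in partial derivatives valid on a
    neighbourhood, so it may be differentiated once more with [v] constant. This links the
    coordinate traces to pure second derivatives along frame vectors. *)
Lemma is_derive2_partial f x v :
  (\forall y \near x, differentiable f y) ->
  (forall j, differentiable (partial j f) x) ->
  is_derive x v ('D_v f)
    (\sum_i \sum_j (v 0 i * v 0 j) *: partial i (partial j f) x).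
Proof.
move=> df ddf.
apply: (@near_eq_is_derive _ _ _ (fun y => \sum_j v 0 j *: partial j f y)).
  by apply: filterS df => y dy; rewrite derive_partial.
have -> : \sum_i \sum_j (v 0 i * v 0 j) *: partial i (partial j f) x
    = \sum_j v 0 j *: 'D_v (partial j f) x.
  rewrite exchange_big /=; apply: eq_bigr => j _.
  rewrite derive_partial // scaler_sumr.
  by apply: eq_bigr => i _; rewrite scalerA mulrC.
by apply: is_derive_bigsum => j; apply: is_deriveZ; exact: is_derive_diff.
Qed.

End CoordinateDerivatives.

(** * Second-derivative test at a local maximum *)

Section SecondDerivativeTest.
Variable R : realType.

(** If the second derivative at [0] were positive, then [f'], which vanishes at [0], would be
    positive just to the right of it, and the mean value theorem would give [f h > f 0] for a small
    [h > 0]. *)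
Lemma second_derivative_max1 (f : R -> R) :
  (\forall t \near (0 : R), derivable f t 1) -> derivable ('D_1 f) 0 1 ->
  (\forall t \near (0 : R), f t <= f 0) ->
  'D_1 f 0 = 0 /\ 'D_1 ('D_1 f) 0 <= 0.
Proof.
move=> df ddf fmax.
have [e /= e0 he] := filterI df fmax.
have {}he t : `|t| < e -> derivable f t 1 /\ f t <= f 0.
  by move=> te; apply: he; rewrite /= sub0r normrN.
have d0 : 'D_1 f 0 = 0.
  have := @derive1_at_max R f (- e) e 0.
  move=> h; apply: derive_val; apply: h.
  - by rewrite ge0_cp // ltW.
  - by move=> t; rewrite in_itv /= -ltr_norml => /he[].
  - by rewrite in_itv /= oppr_lt0 e0.
  - by move=> t; rewrite in_itv /= -ltr_norml => /he[].
split=> //; rewrite leNgt; apply/negP => L0.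
have [h [h0 he1 hf]] : exists h : R, [/\ 0 < h, h < e &
    forall t, 0 < t -> t <= h -> 0 < 'D_1 f t].
  have : h^-1 *: ('D_1 f (h *: 1 + 0) - 'D_1 f 0) @[h --> 0^'] -->
    'D_1 ('D_1 f) 0 by exact: ddf.
  move=> /cvgrPdist_lt/(_ _ L0)[d /= d0' hd].
  exists (Num.min (d / 2) (e / 2)); split.
  - by rewrite lt_min !divr_gt0.
  - by rewrite gt_min; apply/orP; right; lra.
  move=> t t0; rewrite le_min => /andP[td _].
  have := hd t; rewrite /= sub0r normrN gtr0_norm // => /(_ _ (lt0r_neq0 t0)).
  have -> : t < d by lra.
  rewrite d0 subr0 addr0 [t *: 1]mulr1 => /(_ isT).
  rewrite ltr_norml => /andP[_ q0].
  have : 0 < t^-1 *: 'D_1 f t by lra.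
  by rewrite [t^-1 *: _]mulrC pmulr_lgt0 // invr_gt0.
have [||c] := @MVT R f ('D_1 f) 0 h h0.
- move=> t; rewrite in_itv /= => /andP[t0 th].
  have [|dt _] := he t; first by rewrite gtr0_norm // (lt_trans th).
  exact: derivableP.
- apply: derivable_within_continuous => t; rewrite in_itv /= => /andP[t0 th].
  by have [|//] := he t; rewrite ger0_norm // (le_lt_trans th).
rewrite in_itv /= subr0 => /andP[c0 ch] hc.
have [|_] := he h; first by rewrite gtr0_norm.
by rewrite -subr_le0 hc leNgt mulr_gt0 // hf // ltW.
Qed.

Lemma second_derivative_max (V : normedModType R) (f : V -> R) (x v : V) :
  (\forall y \near x, derivable f y v) -> derivable ('D_v f) x v ->
  (\forall y \near x, f y <= f x) ->
  'D_v f x = 0 /\ 'D_v ('D_v f) x <= 0.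
Proof.
move=> df ddf fmax.
pose phi (t : R) := f (t *: v + x).
have line (P : V -> Prop) : (\forall y \near x, P y) ->
    \forall t \near (0 : R), P (t *: v + x).
  move=> hP; have : (fun t : R => t *: v + x) @ (0 : R) --> x.
    rewrite -[X in _ --> X]add0r -[X in X + _](scale0r v).
    by apply: cvgD; [exact: cvgZr_tmp cvg_id|exact: cvg_cst].
  exact.
have dphi t : derivable f (t *: v + x) v -> is_derive t 1 phi ('D_v f (t *: v + x)).
  by move=> h; apply: is_derive_line; exact: derivableP.
have e1 : \forall t \near (0 : R), 'D_1 phi t = 'D_v f (t *: v + x).
  by apply: filterS (line _ df) => t /dphi h; rewrite derive_val.
have := line _ df; have := line _ fmax => /= max1 df1.
have ddphi : is_derive (0 : R) 1 ('D_1 phi) ('D_v ('D_v f) x).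
  apply: (@near_eq_is_derive _ _ _ (fun t : R => 'D_v f (t *: v + x))).
    by apply: filterS e1.
  have h : is_derive (0 *: v + x) v ('D_v f) ('D_v ('D_v f) x).
    by rewrite scale0r add0r; exact: derivableP.
  exact: is_derive_line h.
have [] := @second_derivative_max1 phi.
- by apply: filterS df1 => t /dphi [].
- exact: ex_derive.
- by rewrite /phi scale0r add0r.
by rewrite (nbhs_singleton e1) scale0r add0r derive_val.
Qed.

End SecondDerivativeTest.

(** * Quadratic forms and the Koszul formula *)

Section Forms.
Variables (R : realType) (n : nat).
Implicit Types (a b : 'M[R]_n) (u v w : 'rV[R]_n).

Lemma formE a u v : form a u v = \sum_i \sum_j u 0 i * v 0 j * a i j.
Proof.
rewrite /form mxE exchange_big; apply: eq_bigr => j _ /=.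
rewrite mxE big_distrl /=; apply: eq_bigr => i _.
by rewrite mxE mulrAC.
Qed.

Lemma formDl a u v w : form a (u + v) w = form a u w + form a v w.
Proof. by rewrite /form !mulmxDl mxE. Qed.

Lemma formDr a u v w : form a u (v + w) = form a u v + form a u w.
Proof. by rewrite /form linearD mulmxDr mxE. Qed.

Lemma formZl a (c : R) u v : form a (c *: u) v = c * form a u v.
Proof. by rewrite /form -!scalemxAl mxE. Qed.

Lemma formZr a (c : R) u v : form a u (c *: v) = c * form a u v.
Proof. by rewrite /form linearZ -scalemxAr mxE. Qed.

Lemma formNl a u v : form a (- u) v = - form a u v.
Proof. by rewrite -scaleN1r formZl mulN1r. Qed.

Lemma formNr a u v : form a u (- v) = - form a u v.
Proof. by rewrite -scaleN1r formZr mulN1r. Qed.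

Lemma form0l a u : form a 0 u = 0.
Proof. by rewrite -[X in form _ X](scale0r 0) formZl mul0r. Qed.

Lemma form0r a u : form a u 0 = 0.
Proof. by rewrite -[X in form _ _ X](scale0r 0) formZr mul0r. Qed.

Lemma form_suml a (I : finType) (f : I -> 'rV[R]_n) v :
  form a (\sum_i f i) v = \sum_i form a (f i) v.
Proof. exact: (big_morph _ (fun x y => formDl a x y v) (form0l a v)). Qed.

Lemma formC a u v : a^T = a -> form a u v = form a v u.
Proof.
move=> sa; rewrite {1}/form -[u *m a *m v^T]trmxK [in LHS]mxE.
by rewrite trmx_mul trmx_mul trmxK sa mulmxA.
Qed.

Definition positive_form a := forall u, u != 0 -> 0 < form a u u.

Lemma positive_form_ge0 a u : positive_form a -> 0 <= form a u u.
Proof.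
by move=> pa; have [->|/pa/ltW//] := eqVneq u 0; rewrite form0l.
Qed.

Lemma form_cauchy_schwarz a u v : a^T = a -> positive_form a ->
  form a u v ^+ 2 <= form a u u * form a v v.
Proof.
move=> sa pa; have [->|v0] := eqVneq v 0.
  by rewrite !form0r expr0n mulr0.
have := positive_form_ge0 (form a v v *: u - form a u v *: v) pa.
rewrite !(formDl, formDr, formNl, formNr, formZl, formZr) (formC v u sa).
move: (pa v v0); set s := form a u u; set t := form a u v; set r := form a v v.
move=> r0 h; rewrite -(ler_pM2l r0) -subr_ge0; move: h; congr (0 <= _); ring.
Qed.

(** Gram-Schmidt, one row at a time: the rows of [Q] are orthonormal for [a]. *)
Lemma partial_frame a k : a^T = a -> positive_form a -> (k <= n)%N ->
  exists Q : 'M[R]_(k, n), Q *m a *m Q^T = 1%:M.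
Proof.
move=> sa pa; elim: k => [_|k IH kn].
  by exists 0; apply/matrixP => -[].
have [Q hQ] := IH (ltnW kn).
(* A nonzero vector orthogonal to the rows found so far: [a *m Q^T] has only [k < n] columns, so its
   left kernel is nontrivial. *)
have [u u0 uQ] : exists2 u : 'rV[R]_n, u != 0 & u *m (a *m Q^T) = 0.
  have : kermx (a *m Q^T) != 0.
    rewrite -mxrank_eq0 mxrank_ker subn_eq0 -ltnNge.
    exact: leq_ltn_trans (rank_leq_col _) kn.
  move=> /rowV0Pn[u]; rewrite sub_kermx => /eqP uQ u0.
  by exists u.
have fu := pa _ u0.
pose w := (Num.sqrt (form a u u))^-1 *: u.
have wQ : w *m a *m Q^T = 0 by rewrite -mulmxA -scalemxAl uQ scaler0.
have ww : w *m a *m w^T = 1%:M.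
  apply/matrixP => i j; rewrite !ord1 [RHS]mxE eqxx mulr1n.
  rewrite -[LHS]/(form a w w) formZl formZr mulrA -invfM -expr2 sqr_sqrtr ?ltW //.
  by rewrite mulVf // gt_eqF.
exists (col_mx w Q : 'M_(1 + k, n)).
suff : col_mx w Q *m a *m (col_mx w Q)^T = 1%:M :> 'M_(1 + k) by [].
rewrite tr_col_mx mul_col_mx mul_col_row ww wQ hQ.
have -> : Q *m a *m w^T = 0.
  by apply: trmx_inj; rewrite !trmx_mul trmxK sa mulmxA wQ trmx0.
by rewrite (scalar_mx_block 1 k).
Qed.

(** For square [Q], commuting the factors of [Q *m (a *m Q^T) = 1] turns orthonormality into a
    factorization of the inverse metric, which is the form in which traces use it. *)
Lemma orthonormal_frame a : a^T = a -> positive_form a ->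
  exists Q : 'M[R]_n, [/\ Q *m a *m Q^T = 1%:M, Q \in unitmx, a \in unitmx &
    invmx a = Q^T *m Q].
Proof.
move=> sa pa; have [Q hQ] := partial_frame sa pa (leqnn n).
have hQ' : Q^T *m Q *m a = 1%:M by rewrite -mulmxA; apply: mulmx1C.
have [_ ua] := mulmx1_unit hQ'.
exists Q; split=> //; last by rewrite -[LHS]mul1mx -hQ' mulmxK.
by rewrite -mulmxA in hQ; case/mulmx1_unit : hQ.
Qed.

(** With [a] the inverse metric, this says that a metric trace is the sum of the diagonal values on
    an orthonormal frame, the rows of [Q]. *)
Lemma trace_frame (W : lmodType R) a (Q : 'M[R]_n) (T : 'I_n -> 'I_n -> W) :
  a = Q^T *m Q ->
  \sum_i \sum_j a i j *: T i j
  = \sum_k \sum_i \sum_j (row k Q 0 i * row k Q 0 j) *: T i j.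
Proof.
move=> ->; rewrite [RHS]exchange_big; apply: eq_bigr => i _ /=.
rewrite [RHS]exchange_big; apply: eq_bigr => j _ /=.
rewrite mxE scaler_suml; apply: eq_bigr => k _.
by rewrite !mxE.
Qed.

End Forms.

Section Koszul.
Variables (R : realType) (n : nat) (h : 'rV[R]_n -> 'M[R]_n).
Implicit Types x u v w : 'rV[R]_n.

Lemma form_derive x u v w : differentiable h x ->
  form ('D_u h x) v w = \sum_i \sum_j \sum_l u 0 i * v 0 j * w 0 l *
    partial i (fun y => h y j l) x.
Proof.
move=> dh; rewrite formE [RHS]exchange_big; apply: eq_bigr => j _ /=.
rewrite [RHS]exchange_big; apply: eq_bigr => l _ /=.
rewrite derive_partial // summxE big_distrr /=; apply: eq_bigr => i _.
rewrite mxE mulrA -[v 0 j * w 0 l * _]mulrC mulrA; congr (_ * _).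
by have /is_derive_mxP/(_ j l) := is_derive_diff (delta_mx 0 i) dh; case.
Qed.

Lemma sum_rotate (W : nmodType) (F : 'I_n -> 'I_n -> 'I_n -> W) :
  \sum_i \sum_j \sum_l F i j l = \sum_l \sum_i \sum_j F i j l.
Proof.
rewrite [RHS]exchange_big; apply: eq_bigr => i _ /=.
by rewrite exchange_big.
Qed.

(** For constant coordinate fields the brackets vanish and only derivatives of the coefficients of
    [h] remain. It is applied both to [g] on the base and to [G] on the tangent bundle. *)
Lemma koszul x u v w : (h x)^T = h x -> h x \in unitmx -> differentiable h x ->
  form (h x) (Gamma h x u v) w =
  2^-1 * (form ('D_u h x) v w + form ('D_v h x) u w - form ('D_w h x) u v).
Proof.
move=> sh uh dh.
(* [c] is twice [Gamma h x u v] with its index lowered; in the pairing with [w] the factor [h x]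
   cancels the inverse matrix. *)
pose c := \row_l \sum_i \sum_j u 0 i * v 0 j *
  (partial i (fun y => h y j l) x + partial j (fun y => h y i l) x
   - partial l (fun y => h y i j) x).
have -> : Gamma h x u v = 2^-1 *: (c *m (invmx (h x))^T).
  apply/rowP => k; rewrite !mxE big_distrr /=.
  transitivity (\sum_i \sum_j \sum_l 2^-1 * (u 0 i * v 0 j *
     (partial i (fun y => h y j l) x + partial j (fun y => h y i l) x
       - partial l (fun y => h y i j) x) * invmx (h x) k l)).
    apply: eq_bigr => i _; apply: eq_bigr => j _.
    rewrite /christoffel big_distrr /= !big_distrl /=; apply: eq_bigr => l _.
    ring.
  rewrite sum_rotate; apply: eq_bigr => l _ /=.
  rewrite !mxE big_distrl big_distrr /=; apply: eq_bigr => i _.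
  by rewrite big_distrl big_distrr.
rewrite formZl; congr (_ * _).
rewrite {1}/form trmx_inv sh mulmxKV // mxE !(form_derive _ _ _ dh).
have -> : \sum_i \sum_j \sum_l v 0 i * u 0 j * w 0 l * partial i (fun y => h y j l) x
  = \sum_i \sum_j \sum_l u 0 i * v 0 j * w 0 l * partial j (fun y => h y i l) x.
  rewrite exchange_big; apply: eq_bigr => i _; apply: eq_bigr => j _ /=.
  by apply: eq_bigr => l _; ring.
have -> : \sum_i \sum_j \sum_l w 0 i * u 0 j * v 0 l * partial i (fun y => h y j l) x
  = \sum_i \sum_j \sum_l u 0 i * v 0 j * w 0 l * partial l (fun y => h y i j) x.
  rewrite exchange_big; apply: eq_bigr => i _; rewrite exchange_big /=.
  apply: eq_bigr => j _ /=.
  by apply: eq_bigr => l _; ring.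
rewrite -big_split -sumrB /=.
transitivity (\sum_l \sum_i \sum_j u 0 i * v 0 j * w 0 l *
  (partial i (fun y => h y j l) x + partial j (fun y => h y i l) x
   - partial l (fun y => h y i j) x)).
  apply: eq_bigr => l _; rewrite !mxE big_distrl /=; apply: eq_bigr => i _.
  by rewrite big_distrl /=; apply: eq_bigr => j _; ring.
rewrite -sum_rotate; apply: eq_bigr => i _.
rewrite -big_split -sumrB /=; apply: eq_bigr => j _.
rewrite -big_split -sumrB /=; apply: eq_bigr => l _; ring.
Qed.

End Koszul.

(** * The strong maximum principle *)

Section Limits.
Variables (R : realType) (T : Type) (F : set_system T).
Hypothesis FF : Filter F.

Lemma cvg_sumr (I : Type) (r : seq I) (f : I -> T -> R) (l : I -> R) :
  (forall i, f i y @[y --> F] --> l i) ->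
  \sum_(i <- r) f i y @[y --> F] --> \sum_(i <- r) l i.
Proof.
move=> fl; elim: r => [|i r IH].
  by under eq_fun do rewrite big_nil; rewrite big_nil; exact: cvg_cst.
under eq_fun do rewrite big_cons; rewrite big_cons.
by apply: cvgD IH; exact: fl.
Qed.

Lemma cvg_prodr (I : Type) (r : seq I) (f : I -> T -> R) (l : I -> R) :
  (forall i, f i y @[y --> F] --> l i) ->
  \prod_(i <- r) f i y @[y --> F] --> \prod_(i <- r) l i.
Proof.
move=> fl; elim: r => [|i r IH].
  by under eq_fun do rewrite big_nil; rewrite big_nil; exact: cvg_cst.
under eq_fun do rewrite big_cons; rewrite big_cons.
by apply: cvgM IH; exact: fl.
Qed.

Lemma cvg_form n (a : T -> 'M[R]_n) (u v : T -> 'rV[R]_n)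
    (la : 'M[R]_n) (lu lv : 'rV[R]_n) :
  (forall i j, a y i j @[y --> F] --> la i j) ->
  (forall j, u y 0 j @[y --> F] --> lu 0 j) ->
  (forall j, v y 0 j @[y --> F] --> lv 0 j) ->
  form (a y) (u y) (v y) @[y --> F] --> form la lu lv.
Proof.
move=> al ul vl; under eq_fun do rewrite formE; rewrite formE.
apply: cvg_sumr => i; apply: cvg_sumr => j.
by apply: cvgM; [apply: cvgM|].
Qed.

End Limits.

Section StrongMaximumPrinciple.
Variables (R : realType) (n : nat).
Implicit Types (x y z c u v w : 'rV[R]_n).

(** Euclidean on purpose: the norm of ['rV[R]_n] is the sup norm, whose balls are neither smooth nor
    strictly convex. Sup-norm balls serve below only as compact neighbourhoods. *)
Definition sqdist c x : R := form 1%:M (x - c) (x - c).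

Lemma form1E u v : form 1%:M u v = \sum_i u 0 i * v 0 i.
Proof. by rewrite /form mulmx1 mxE; apply: eq_bigr => i _; rewrite mxE. Qed.

Lemma form1C u v : form 1%:M u v = form 1%:M v u.
Proof. by rewrite formC // trmx1. Qed.

Lemma sqr_norm_le_form1 u : `|u| ^+ 2 <= form 1%:M u u.
Proof.
have h0 (P : pred 'I_n) : 0 <= \sum_(i | P i) u 0 i * u 0 i.
  by apply: sumr_ge0 => i _; rewrite -expr2 sqr_ge0.
rewrite form1E; have [->|] := eqVneq `|u| 0; first by rewrite expr0n h0.
move=> /mx_norm_neq0[[i j]] /= e; rewrite -[`|u|]/(mx_norm u) e (ord1 i) real_normK ?num_real //.
by rewrite (bigD1 j) //= expr2 lerDl.
Qed.

Lemma positive_form1 : positive_form (1%:M : 'M[R]_n).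
Proof.
move=> u u0; apply: lt_le_trans (sqr_norm_le_form1 u).
by rewrite exprn_gt0 // normr_gt0.
Qed.

(* Strict convexity of Euclidean balls: the ball of radius [|v|] around [0] is
   internally tangent at [v] to the one of radius [2|v|] around [-v]. *)
Lemma form1_tangent u v : form 1%:M u u <= form 1%:M v v ->
  form 1%:M (2 *: v) (2 *: v) <= form 1%:M (u + v) (u + v) -> u = v.
Proof.
rewrite !(formDl, formDr, formZl, formZr) (form1C v u) => h1 h2.
apply/eqP; rewrite -subr_eq0; apply/negPn/negP => /positive_form1.
rewrite !(formDl, formDr, formNl, formNr) (form1C v u); lra.
Qed.

Lemma sub_coord_cvg c z j : (x - c) 0 j @[x --> z] --> (z - c) 0 j.
Proof.
have h y : (y - c) 0 j = y 0 j - c 0 j by rewrite !mxE.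
rewrite h (_ : (fun x => _) = (fun x : 'rV[R]_n => x 0 j) - cst (c 0 j)).
  by apply: (@cvgB _ _ _ (nbhs z)); [exact: coord_continuous|exact: cvg_cst].
exact/funext.
Qed.

Lemma sqdist_cvg c z : sqdist c x @[x --> z] --> sqdist c z.
Proof.
apply: (@cvg_form _ _ (nbhs z)) => [i j|j|j]; last 2 first.
- exact: sub_coord_cvg.
- exact: sub_coord_cvg.
exact: cvg_cst.
Qed.

Lemma is_derive_sqdist c x w :
  is_derive x w (sqdist c) (2 * form 1%:M w (x - c)).
Proof.
have h : is_derive x w (fun y : 'rV[R]_n => y - c) w.
  by rewrite -[X in is_derive _ _ _ X]subr0; apply: is_derive_sub.
apply: is_derive_eq (is_derive_form _ h h) _.
by rewrite [X in X + _ + _]/form mulmx0 mul0mx mxE add0r (form1C (x - c)); ring.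
Qed.

(* Hopf's barrier, quadratic in [sqdist c] rather than exponential: it vanishes
   on the sphere [sqdist c = r], is negative just outside of it and, for [N]
   large, is strictly subharmonic near a given point of it. *)
Definition barrier N c r x : R := N * ((sqdist c x - r) * (sqdist c x - r)) - (sqdist c x - r).

Lemma barrier_cvg N c r z : barrier N c r x @[x --> z] --> barrier N c r z.
Proof.
have d : sqdist c x - r @[x --> z] --> sqdist c z - r.
  exact: (@cvgB _ _ _ (nbhs z) _ _ _ _ _ (@sqdist_cvg c z) (@cvg_cst _ r _ _ _)).
have h : N * ((sqdist c x - r) * (sqdist c x - r)) @[x --> z] -->
    N * ((sqdist c z - r) * (sqdist c z - r)).
  apply: (@cvgM R _ (nbhs z)); first exact: (@cvg_cst _ N _ (nbhs z)).
  exact: (@cvgM R _ (nbhs z) _ _ _ _ _ d d).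
exact: (@cvgB _ _ _ (nbhs z) _ _ _ _ _ h d).
Qed.

(** The derivative of the barrier with respect to [sqdist c x]; it equals [-1] on the sphere
    [sqdist c x = r]. *)
Definition barrier_slope N c r x : R := 2 * N * (sqdist c x - r) - 1.

Lemma is_derive_barrier N c r x w :
  is_derive x w (barrier N c r)
    (barrier_slope N c r x * (2 * form 1%:M w (x - c))).
Proof.
have h := is_derive_sub (is_derive_sqdist c x w) (is_derive_cst r x w).
have := is_derive_sub (is_derive_mul (is_derive_cst N x w) (is_derive_mul h h)) h.
rewrite /barrier /cst.
by move=> k; apply: is_derive_eq k _; rewrite /barrier_slope; ring.
Qed.

Lemma is_derive2_barrier N c r x w :
  is_derive x w ('D_w (barrier N c r))
    (8 * N * form 1%:M w (x - c) ^+ 2 +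
     2 * barrier_slope N c r x * form 1%:M w w).
Proof.
have -> : 'D_w (barrier N c r) =
    fun y => barrier_slope N c r y * (2 * form 1%:M w (y - c)).
  by apply/funext => y; have [] := is_derive_barrier N c r y w.
have h : is_derive x w (fun y : 'rV[R]_n => y - c) w.
  by rewrite -[X in is_derive _ _ _ X]subr0; apply: is_derive_sub.
have h1 := is_derive_form (is_derive_cst (1%:M : 'M_n) x w) (is_derive_cst w x w) h.
have h2 := is_derive_sub (is_derive_sqdist c x w) (is_derive_cst r x w).
have h3 := is_derive_sub (is_derive_mul (is_derive_cst (2 * N) x w) h2)
  (is_derive_cst (1 : R) x w).
have := is_derive_mul h3 (is_derive_mul (is_derive_cst (2 : R) x w) h1).
rewrite /cst => k; apply: is_derive_eq k _.
rewrite [form 0 _ _]/form mulmx0 mul0mx mxE form0l /barrier_slope; ring.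
Qed.

Variables (U : set 'rV[R]_n) (a : 'rV[R]_n -> 'M[R]_n).
Variables (b : 'rV[R]_n -> 'rV[R]_n) (S : 'rV[R]_n -> R) (m : R).
Hypothesis openU : open U.
Hypothesis a_frame : forall x, U x ->
  exists2 Q : 'M[R]_n, Q \in unitmx & a x = Q^T *m Q.
Hypothesis a_cvg : forall x, U x -> forall i j, a y i j @[y --> x] --> a x i j.
Hypothesis b_cvg : forall x, U x -> forall j, b y 0 j @[y --> x] --> b x 0 j.
Hypothesis diffS : forall x, U x -> differentiable S x.
Hypothesis diff2S : forall x, U x -> forall j, differentiable (partial j S) x.
Hypothesis subS : forall x, U x ->
  0 <= \sum_i \sum_j a x i j *: partial i (partial j S) x - 'D_(b x) S x.
Hypothesis leS : forall x, U x -> S x <= m.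

Lemma form_frame (Q : 'M[R]_n) u :
  form (Q^T *m Q) u u = \sum_k form 1%:M (row k Q) u ^+ 2.
Proof.
rewrite /form mulmxA -mulmxA mxE; apply: eq_bigr => k _.
rewrite -/(form _ _ _) expr2 form1E; congr (_ * _).
  by rewrite mxE; apply: eq_bigr => i _; rewrite !mxE mulrC.
by rewrite mxE; apply: eq_bigr => i _; rewrite !mxE.
Qed.

Lemma tr_frame (Q : 'M[R]_n) :
  \tr (Q^T *m Q) = \sum_k form 1%:M (row k Q) (row k Q).
Proof.
rewrite mxtrace_mulC; apply: eq_bigr => k _.
by rewrite form1E mxE; apply: eq_bigr => i _; rewrite !mxE.
Qed.

Lemma form_frame_gt0 (Q : 'M[R]_n) u : Q \in unitmx -> u != 0 ->
  0 < form (Q^T *m Q) u u.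
Proof.
move=> uQ u0; have -> : form (Q^T *m Q) u u = form 1%:M (u *m Q^T) (u *m Q^T).
  by rewrite /form mulmx1 trmx_mul trmxK !mulmxA.
apply: positive_form1; apply: contra u0 => /eqP h.
by rewrite -[u](@mulmxK _ _ _ Q^T) ?unitmx_tr // h mul0mx.
Qed.

(** The operator [a^{ij} D_i D_j - D_b], for which [S] is subharmonic, applied to
    [barrier N c r]. *)
Definition barrier_operator N c r x : R :=
  8 * N * form (a x) (x - c) (x - c)
  + 2 * barrier_slope N c r x * \tr (a x)
  - barrier_slope N c r x * (2 * form 1%:M (b x) (x - c)).

(** At a local maximum first derivatives vanish and pure second derivatives are nonpositive. Summing
    the latter over the rows of [Q], with [a x = Q^T *m Q], shows that the operator is nonpositive
    on [S + e * barrier], against [subS] and the strict sign on the barrier. *)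
Lemma barrier_no_max N c r e x : U x -> 0 <= e -> 0 < e * barrier_operator N c r x ->
  ~ \forall y \near x, S y + e * barrier N c r y <= S x + e * barrier N c r x.
Proof.
move=> Ux e0 Lpos fmax.
pose f y := S y + e * barrier N c r y.
have df y w : U y -> is_derive y w f
    ('D_w S y + e * 'D_w (barrier N c r) y).
  move=> Uy; apply: is_derive_add; first exact: is_derive_diff (diffS Uy).
  apply: is_derive_eq (is_derive_mul (is_derive_cst e y w) _) _.
    by apply: derivableP; case: (is_derive_barrier N c r y w).
  by rewrite mul0r add0r.
have nearU : \forall y \near x, U y by exact: open_nbhs_nbhs.
have ddf w : is_derive x w ('D_w f)
  (\sum_i \sum_j (w 0 i * w 0 j) *: partial i (partial j S) x +
   e * (8 * N * form 1%:M w (x - c) ^+ 2 +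
     2 * barrier_slope N c r x * form 1%:M w w)).
  apply: (@near_eq_is_derive _ _ _
      (fun y => 'D_w S y + e * 'D_w (barrier N c r) y)).
    by apply: filterS nearU => y /(df _ w) [].
  apply: is_derive_add.
    apply: is_derive2_partial; last exact: diff2S.
    by apply: filterS nearU => y; exact: diffS.
  apply: is_derive_eq
    (is_derive_mul (is_derive_cst e x w) (is_derive2_barrier N c r x w)) _.
  by rewrite mul0r add0r.
have max2 w : 'D_w f x = 0 /\ 'D_w ('D_w f) x <= 0.
  apply: second_derivative_max => //.
  by apply: filterS nearU => y /(df _ w) [].
have [Q uQ aQ] := a_frame Ux.
have bx : 'D_(b x) S x + e * (barrier_slope N c r x * (2 * form 1%:M (b x) (x - c))) = 0.
  have [<- _] := max2 (b x); have [_ ->] := df x (b x) Ux.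
  by have [_ ->] := is_derive_barrier N c r x (b x).
have : \sum_k 'D_(row k Q) ('D_(row k Q) f) x <= 0.
  by apply: sumr_le0 => k _; case: (max2 (row k Q)).
have -> : \sum_k 'D_(row k Q) ('D_(row k Q) f) x =
    \sum_i \sum_j a x i j *: partial i (partial j S) x
    + e * (8 * N * form (a x) (x - c) (x - c)
      + 2 * barrier_slope N c r x * \tr (a x)).
  rewrite (trace_frame _ aQ) aQ form_frame tr_frame !mulr_sumr -big_split /=.
  rewrite mulr_sumr -big_split /=; apply: eq_bigr => k _.
  by have [_ ->] := ddf (row k Q).
have := subS Ux; move: Lpos; rewrite /barrier_operator; lra.
Qed.

Lemma barrier_operator_cvg N c r x : U x ->
  barrier_operator N c r y @[y --> x] --> barrier_operator N c r x.
Proof.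
move=> Ux.
have cst k : (k : R) @[y --> x] --> k by exact: (@cvg_cst _ k _ (nbhs x) _).
have cD (f g : 'rV[R]_n -> R) (k l : R) : f y @[y --> x] --> k ->
  g y @[y --> x] --> l -> f y + g y @[y --> x] --> k + l 
  by move=> h1 h2; exact: (@cvgD _ _ _ (nbhs x) _ _ _ _ _ h1 h2).
have cB (f g : 'rV[R]_n -> R) (k l : R) : f y @[y --> x] --> k ->
  g y @[y --> x] --> l -> f y - g y @[y --> x] --> k - l 
  by move=> h1 h2; exact: (@cvgB _ _ _ (nbhs x) _ _ _ _ _ h1 h2).
have cM (f g : 'rV[R]_n -> R) (k l : R) : f y @[y --> x] --> k ->
  g y @[y --> x] --> l -> f y * g y @[y --> x] --> k * l 
  by move=> h1 h2; exact: (@cvgM _ _ (nbhs x) _ _ _ _ _ h1 h2).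
have s : barrier_slope N c r y @[y --> x] --> barrier_slope N c r x.
  by apply: (cB) => //; apply: (cM) => //; apply: (cB) => //; exact: sqdist_cvg.
apply: (cB).
  apply: (cD).
    apply: (cM) => //; apply: (@cvg_form _ _ (nbhs x)); first exact: a_cvg.
      exact: sub_coord_cvg.
    exact: sub_coord_cvg.
  apply: (cM); first exact: cM.
  by apply: (@cvg_sumr _ _ (nbhs x)) => i; exact: a_cvg.
apply: (cM) => //; apply: (cM) => //.
apply: (@cvg_form _ _ (nbhs x)); last exact: sub_coord_cvg.
  by move=> i j; exact: cvg_cst.
exact: b_cvg.
Qed.

Lemma closed_ball_in_nbhs z (P : set 'rV[R]_n) : nbhs z P ->
  exists d : R, 0 < d /\ closed_ball z d `<=` P.
Proof. by move=> /nbhs_closedballP[d hd]; exists d%:num. Qed.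

Lemma compact_closed_ball z (d : R) : 0 < d -> compact (closed_ball z d).
Proof.
move=> d0; apply: bounded_closed_compact; last exact: closed_ball_closed.
exists (`|z| + d); split; first exact: num_real.
move=> M hM x; rewrite closed_ballE // /closed_ball_ /= => h.
rewrite (le_trans _ (ltW hM)) // -[x](subrK z) addrC.
by rewrite (le_trans (ler_normD _ _)) // lerD2l distrC.
Qed.

Lemma continuous_max_compact (K : set 'rV[R]_n) (f : 'rV[R]_n -> R) :
  K !=set0 -> compact K -> (forall x, K x -> {for x, continuous f}) ->
  exists2 y, K y & forall x, K x -> f x <= f y.
Proof.
move=> K0 cK cf; have [|y yK hy] := EVT_max_rV K0 cK (f := f).
  by apply: continuous_in_subspaceT => x /set_mem; exact: cf.
by exists y => [|x Kx]; [exact: set_mem|apply: hy; exact: mem_set].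
Qed.

(** Hopf's argument. If a Euclidean ball met the level set [S = m] only at its boundary point [z], a
    small multiple of the barrier added to [S] would have a maximum in the interior of a
    neighbourhood of [z], which [barrier_no_max] excludes. *)
Lemma no_touching_ball c z : U z -> S z = m -> z != c ->
  (\forall x \near z, sqdist c x <= sqdist c z -> S x = m -> x = z) -> False.
Proof.
move=> Uz Sz zc touch.
pose r := sqdist c z; pose al := form (a z) (z - c) (z - c).
have al0 : 0 < al.
  have [Q uQ aQ] := a_frame Uz; rewrite /al aQ.
  by apply: form_frame_gt0; rewrite // subr_eq0.
(* At [z] the slope is [-1], so the operator there equals [8 * N * al - ka]; the choice of [N] makes
   the first term [|ka| + 1]. *)
pose ka := 2 * \tr (a z) - 2 * form 1%:M (b z) (z - c).
pose N := (`|ka| + 1) / (8 * al).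
have N0 : 0 < N by rewrite divr_gt0 ?mulr_gt0 // ltr_wpDl.
have Lz : 0 < barrier_operator N c r z.
  have e : 8 * N * al = `|ka| + 1.
    by rewrite /N; field; rewrite gt_eqF.
  rewrite /barrier_operator /barrier_slope -/al e subrr mulr0 sub0r.
  have := ler_norm ka; rewrite {1}/ka; lra.
have near_good : \forall x \near z, [/\ U x, 0 < barrier_operator N c r x,
    N * (sqdist c x - r) < 1 & (sqdist c x <= r -> S x = m -> x = z)].
  have h1 : \forall x \near z, 0 < barrier_operator N c r x.
    exact: (@cvgr_gt R _ (nbhs z) _ _ _ (@barrier_operator_cvg N c r z Uz)).
  have h2 : \forall x \near z, sqdist c x < r + N^-1.
    apply: (@cvgr_lt R _ (nbhs z) _ _ _ (sqdist_cvg (c := c) (z := z))).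
    by rewrite ltrDl invr_gt0.
  have h3 : \forall x \near z, U x by exact: open_nbhs_nbhs.
  near=> x; split; try by near: x.
  rewrite -ltr_pdivlMl // mulr1 ltrBlDl; by near: x.
have [d [d0 hd]] := closed_ball_in_nbhs near_good.
pose K := closed_ball z d.
have KE x : K x <-> `|z - x| <= d by rewrite /K closed_ballE.
have cK : compact K by exact: compact_closed_ball.
have Kz : K z by apply/KE; rewrite subrr normr0 ltW.
have cS x : K x -> {for x, continuous S}.
  by move=> /hd[Ux _ _ _]; exact/differentiable_continuous/diffS.
have cv x : {for x, continuous (barrier N c r)} by exact: barrier_cvg.
have vz : barrier N c r z = 0 by rewrite /barrier subrr !mulr0 subr0.
(* The part of the boundary of [K] lying in the Euclidean ball. It misses [z], so [S < m] on it, and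
   compactness gives a uniform gap [m - m']. *)
pose T := K `&` [set x | d <= `|z - x|] `&` [set x | sqdist c x <= r].
have [m' m'm hm'] : exists2 m', m' < m & forall x, T x -> S x <= m'.
  have [->|/set0P T0] := eqVneq T set0; first by exists (m - 1) => //; lra.
  have cT : compact T.
    apply: compact_closedI; first apply: compact_closedI => //.
      apply: (preimage_closed (f := fun x => `|z - x|) _ (@closed_ge _ d)) => x _.
      have h : z - y @[y --> x] --> z - x.
        by apply: (@cvgB _ _ _ (nbhs x)); [exact: cvg_cst|exact: cvg_id].
      exact: (@cvg_norm _ _ _ (nbhs x) _ _ _ h).
    apply: (preimage_closed (f := sqdist c) _ (@closed_le _ r)) => x _.
    exact: sqdist_cvg.
  have [|y [[Ky dy] ry] hy] := continuous_max_compact T0 cT (f := S).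
    by move=> x [[Kx _] _]; exact: cS.
  exists (S y) => //; have [Uy _ _ ty] := hd _ Ky.
  rewrite lt_neqAle leS // andbT; apply/eqP => Sy.
  by move: dy; rewrite /= (ty ry Sy) subrr normr0 leNgt d0.
have [|w _ hw] := continuous_max_compact (ex_intro _ z Kz) cK (f := barrier N c r).
  by move=> x _; exact: cv.
set Vm := barrier N c r w in hw.
have Vm0 : 0 <= Vm by rewrite -vz; exact: hw.
(* Small enough that [e * barrier] cannot fill the gap on [T]; the [+ 1] keeps the denominator
   positive when [Vm = 0]. *)
pose e := (m - m') / (Vm + 1).
have e0 : 0 < e by rewrite divr_gt0 // ?subr_gt0 // ltr_wpDl.
have eVm : e * Vm < m - m'.
  have -> : m - m' = e * (Vm + 1) by rewrite /e divfK // gt_eqF // ltr_wpDl.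
  by rewrite ltr_pM2l // ltrDl.
pose f x := S x + e * barrier N c r x.
have [|y Ky hy] := continuous_max_compact (ex_intro _ z Kz) cK (f := f).
  move=> x Kx; apply: (@cvgD _ _ _ (nbhs x)); first exact: cS.
  by apply: (@cvgM _ _ (nbhs x)); [exact: cvg_cst|exact: cv].
have [Uy Ly Ny _] := hd _ Ky.
have [ltd|led] := ltP `|z - y| d.
  apply: (@barrier_no_max N c r e y Uy (ltW e0)); first by rewrite mulr_gt0.
  have : nbhs y (ball z d) by apply: open_nbhs_nbhs; split;
    [exact: ball_open|rewrite -ball_normE].
  by apply: filterS => x xd; apply: hy; exact: subset_closed_ball.
(* The maximum lies on the boundary of [K]. Its value is at least [f z = m] while [S y <= m], so the
   barrier is nonnegative at [y]. Outside the ball [q = sqdist c y - r] would give the value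
   [q * (N * q - 1) < 0]; hence [y] is in [T], where [f] stays below [m]. *)
have := hy z Kz; rewrite /f vz mulr0 addr0 Sz => fy.
have Sy := leS Uy.
have vy : 0 <= barrier N c r y.
  by rewrite -(pmulr_rge0 _ e0); lra.
have qy : sqdist c y <= r.
  rewrite leNgt; apply/negP => qr; move: vy Ny; rewrite /barrier.
  move: qr; rewrite -subr_gt0; set q := sqdist c y - r; nra.
have /hm' Sym' : T y by split.
have : e * barrier N c r y <= e * Vm by rewrite ler_pM2l // hw.
lra.
Unshelve. all: by end_near. Qed.

(** Otherwise some point off the level set [S = m] lies arbitrarily close to [x0], and its nearest
    point on that set produces a touching ball. *)
Lemma maximum_locally_constant x0 : U x0 -> S x0 = m ->
  \forall x \near x0, S x = m.
Proof.
move=> Ux0 Sx0; apply: contrapT => not_near.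
have [d [d0 hd]] := closed_ball_in_nbhs (open_nbhs_nbhs (conj openU Ux0)).
pose K := closed_ball x0 d.
have KE x : K x <-> `|x0 - x| <= d by rewrite /K closed_ballE.
have d2 : 0 < d / 2 by rewrite divr_gt0.
(* The nearest point [z] is at Euclidean distance less than [d / 2] from [x1], because [x0] already
   is. The two halves add up to [|x0 - z| < d], which puts [z] in the interior of [K], so that
   minimality applies to all level points near [z]. *)
have [x1 [x1d x1e Sx1]] : exists x1, [/\ `|x0 - x1| < d / 2,
    sqdist x1 x0 < (d / 2) ^+ 2 & S x1 != m].
  apply: contrapT => no; apply: not_near.
  have h : \forall x \near x0, `|x0 - x| < d / 2.
    by apply/nbhs_ballP; exists (d / 2) => //= x; rewrite -ball_normE.
  have h' : \forall x \near x0, sqdist x0 x < (d / 2) ^+ 2.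
    apply: (@cvgr_lt R _ (nbhs x0) _ _ _ (sqdist_cvg (c := x0) (z := x0))).
    by rewrite /sqdist subrr form0l exprn_gt0.
  apply: filterS2 h h' => x hx hx'; apply/eqP/negPn/negP => Sx.
  apply: no; exists x; split => //.
  suff <- : sqdist x0 x = sqdist x x0 by [].
  by rewrite /sqdist -opprB formNl formNr opprK.
pose F := K `&` [set x | S x = m].
have Fx0 : F x0 by split => //; apply/KE; rewrite subrr normr0 ltW.
have cF : compact F.
  apply: (@subclosed_compact _ F K); [|exact: compact_closed_ball|by move=> x []].
  have cK : closed K by exact: closed_ball_closed.
  rewrite closedE => x nF; apply: contrapT => nFx; apply: nF.
  have [Kx|nKx] := pselect (K x); last first.
    have : nbhs x (~` K) by apply: open_nbhs_nbhs; split => //; exact: closed_openC.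
    by apply: filterS => y nKy [].
  have Sx : S x < m.
    rewrite lt_neqAle leS ?andbT; last exact: hd.
    by apply/eqP => Sx; exact: nFx.
  have cS : S @ x --> S x by exact/differentiable_continuous/diffS/hd.
  apply: filterS (@cvgr_lt R _ (nbhs x) _ _ _ cS m Sx) => y Sy [_ /= Sym].
  by rewrite Sym ltxx in Sy.
have [|z [Kz Sz] hz] := continuous_max_compact (ex_intro _ x0 Fx0) cF
    (f := fun x => - sqdist x1 x).
  by move=> x _; apply: (@cvgN _ _ _ (nbhs x)); exact: sqdist_cvg.
have {}hz x : F x -> sqdist x1 z <= sqdist x1 x by move=> /hz; rewrite lerN2.
have zx1 : z != x1 by apply: contra Sx1 => /eqP <-; rewrite Sz.
(* [z] is a point of the level set closest to [x1]; the ball centred at the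
   midpoint [c] meets the level set at [z] only. *)
pose c := 2^-1 *: (z + x1).
have ec : z - c = c - x1.
  by apply/rowP => j; rewrite !mxE; field.
apply: (@no_touching_ball c z (hd _ Kz) Sz).
  apply: contra zx1 => /eqP zc; move: ec; rewrite -zc subrr => /esym/eqP.
  by rewrite subr_eq0.
have near_K : \forall x \near z, K x.
  have zd : `|x0 - z| < d.
    have h1 : `|z - x1| < d / 2.
      rewrite -(ltr_pXn2r (n := 2)) ?nnegrE // ?(ltW d2) //.
      apply: le_lt_trans (sqr_norm_le_form1 _) _.
      by apply: le_lt_trans (hz _ Fx0) x1e.
    rewrite -(subrKA x1) (le_lt_trans (ler_normD _ _)) //.
    by rewrite [ltRHS](splitr d) ltrD // distrC.
  have : nbhs z (ball x0 d) by apply: open_nbhs_nbhs; split;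
    [exact: ball_open|rewrite -ball_normE].
  by apply: filterS => x; exact: subset_closed_ball.
apply: filterS near_K => x Kx xc Sx.
have := hz _ (conj Kx Sx); move: xc; rewrite /sqdist.
have -> : z - x1 = 2 *: (z - c).
  by rewrite scaler_nat mulr2n {2}ec addrA subrK.
have -> : x - x1 = (x - c) + (z - c) by rewrite ec addrA subrK.
by move=> h1 h2; have := form1_tangent h1 h2; exact: addIr.
Qed.

End StrongMaximumPrinciple.

(** * The radial part of the vertical tension *)

Section HalfLineExtension.
Variable R : realType.

Lemma is_derive_comp1 (V : normedModType R) (q : V -> R) (h : R -> R) x w dh :
  differentiable q x -> is_derive (q x) 1 h dh ->
  is_derive x w (fun y => h (q y)) (dh * 'D_w q x).
Proof.
move=> dq [dh1 dh2].
have dh' : differentiable h (q x) by exact/derivable1_diffP.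
split; first by apply: diff_derivable; exact: differentiable_comp.
have -> : 'D_w (fun y => h (q y)) x = 'D_('D_w q x) h (q x).
  exact: (derive_comp w dq dh').
rewrite -dh2 !deriveE // -[X in 'd h _ X](mulr1).
by rewrite [LHS]linearZ mulrC.
Qed.

(* Reduces the chain rule for [B (|sigma|^2)] to the two-sided one, also at the
   zeros of [sigma], where [B] only has a right derivative. *)
Lemma halfline_extension (f : R -> R) s : 0 <= s -> hderivable f s ->
  exists2 h : R -> R, forall t, 0 <= t -> h t = f t & is_derive s 1 h (hderive f s).
Proof.
move=> s0 df.
pose F t := if 0 <= t then f t else f s + (t - s) * hderive f s.
exists F; first by move=> t; rewrite /F => ->.
have Fs : F s = f s by rewrite /F s0.
suff cv : (fun t : R => t^-1 *: ((F \o shift s) (t *: 1) - F s)) @ 0^'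
    --> hderive f s.
  by split; [apply/cvg_ex; exists (hderive f s)|exact: cvg_lim].
have lf : (fun h => h^-1 * (f (s + h) - f s)) @ within [set h | 0 <= s + h] 0^'
    --> hderive f s by exact: df.
apply/cvgrPdist_lt => e e0; move/cvgrPdist_lt : lf => /(_ e e0).
rewrite near_withinE => lf.
have t0 : \forall t \near (0 : R)^', t != 0 by exact: nbhs_dnbhs_neq.
apply: filterS2 lf t0 => t lf t0; rewrite /= Fs [t *: 1]mulr1 [t + s]addrC /F.
case: ifPn => [st|_]; first exact: lf.
have -> : f s + (s + t - s) * hderive f s - f s = t * hderive f s by ring.
by rewrite [_ *: _]mulKf // subrr normr0.
Qed.

End HalfLineExtension.

(** * Compatibility of the Christoffel symbols with the metric *)

Section MetricCompatibility.
Variables (R : realType) (n : nat) (U : set 'rV[R]_n) (g : 'rV[R]_n -> 'M[R]_n).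
Hypothesis openU : open U.
Hypothesis symg : forall x, U x -> (g x)^T = g x.
Hypothesis unitg : forall x, U x -> g x \in unitmx.
Hypothesis diffg : forall x, U x -> differentiable g x.

Lemma derive_sym x w : U x -> ('D_w g x)^T = 'D_w g x.
Proof.
move=> Ux; have h := is_derive_diff w (diffg Ux).
apply/matrixP => i j; rewrite mxE.
have /is_derive_mxP/(_ j i) [_ <-] := h.
have /is_derive_mxP/(_ i j) [_ <-] := h.
apply: near_eq_derive; apply: filterS (open_nbhs_nbhs (conj openU Ux)) => y Uy.
by rewrite -[in RHS]symg // mxE.
Qed.

(** In the sum of the Koszul formulas for [(w, u; v)] and [(w, v; u)] the derivatives along [u] and
    [v] cancel, and the two along [w] agree by symmetry. *)
Lemma metric_compatibility x w u v : U x ->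
  form ('D_w g x) u v = form (g x) (Gamma g x w u) v + form (g x) u (Gamma g x w v).
Proof.
move=> Ux; have sg := symg Ux; have ug := unitg Ux; have dg := diffg Ux.
have k2 := koszul w v u sg ug dg; have ds := formC v u (derive_sym w Ux).
rewrite (formC u (Gamma g x w v) sg) (koszul w u v sg ug dg) k2 {k2}.
move: ds; generalize (form ('D_w g x) v u) (form ('D_w g x) u v).
generalize (form ('D_u g x) w v) (form ('D_v g x) w u) => p q a b ->.
by field.
Qed.

Lemma derive_sqnorm x w (s : 'rV[R]_n -> 'rV[R]_n) ds : U x ->
  is_derive x w s ds ->
  is_derive x w (fun y => form (g y) (s y) (s y))
    (2 * form (g x) (ds + Gamma g x w (s x)) (s x)).
Proof.
move=> Ux hs; apply: is_derive_eq (is_derive_form (is_derive_diff w (diffg Ux)) hs hs) _.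
rewrite metric_compatibility // (formC (s x) (Gamma g x w (s x)) (symg Ux)).
by rewrite (formC (s x) ds (symg Ux)) formDl; ring.
Qed.

End MetricCompatibility.

Section GammaBilinear.
Variables (R : realType) (n : nat) (h : 'rV[R]_n -> 'M[R]_n) (z : 'rV[R]_n).
Implicit Types u v w : 'rV[R]_n.

Lemma GammaDl u v w : Gamma h z (u + v) w = Gamma h z u w + Gamma h z v w.
Proof.
apply/rowP => k; rewrite !mxE -big_split; apply: eq_bigr => i _ /=.
by rewrite -big_split; apply: eq_bigr => j _ /=; rewrite mxE; ring.
Qed.

Lemma GammaDr u v w : Gamma h z u (v + w) = Gamma h z u v + Gamma h z u w.
Proof.
apply/rowP => k; rewrite !mxE -big_split; apply: eq_bigr => i _ /=.
by rewrite -big_split; apply: eq_bigr => j _ /=; rewrite mxE; ring.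
Qed.

Lemma GammaZl c u v : Gamma h z (c *: u) v = c *: Gamma h z u v.
Proof.
apply/rowP => k; rewrite !mxE big_distrr; apply: eq_bigr => i _ /=.
by rewrite big_distrr; apply: eq_bigr => j _ /=; rewrite mxE; ring.
Qed.

Lemma GammaZr u c v : Gamma h z u (c *: v) = c *: Gamma h z u v.
Proof.
apply/rowP => k; rewrite !mxE big_distrr; apply: eq_bigr => i _ /=.
by rewrite big_distrr; apply: eq_bigr => j _ /=; rewrite mxE; ring.
Qed.

Lemma Gamma0l v : Gamma h z 0 v = 0.
Proof. by rewrite -[X in Gamma h z X _](scale0r (0 : 'rV[R]_n)) GammaZl scale0r. Qed.

Lemma Gamma0r v : Gamma h z v 0 = 0.
Proof. by rewrite -[X in Gamma h z _ X](scale0r (0 : 'rV[R]_n)) GammaZr scale0r. Qed.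

Lemma Gamma_sum (I : finType) (c : I -> R) (p : I -> 'rV[R]_n) :
  Gamma h z (\sum_i c i *: p i) (\sum_j c j *: p j) =
  \sum_i \sum_j (c i * c j) *: Gamma h z (p i) (p j).
Proof.
rewrite (big_morph _ (fun a b => GammaDl a b _) (Gamma0l _)).
apply: eq_bigr => i _; rewrite (big_morph _ (GammaDr _) (Gamma0r _)).
by apply: eq_bigr => j _; rewrite GammaZl GammaZr scalerA.
Qed.

Lemma Gamma_diag w :
  Gamma h z w w = \sum_i \sum_j (w 0 i * w 0 j) *: \row_k christoffel h z i j k.
Proof.
apply/rowP => k; rewrite !mxE summxE; apply: eq_bigr => i _.
by rewrite summxE; apply: eq_bigr => j _; rewrite !mxE; ring.
Qed.

End GammaBilinear.

(** * Tension paired with the radial vertical vector, and subharmonicity *)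

Section VerticalTension.
Variables (R : realType) (n : nat) (U : set 'rV[R]_n).
Variables (g : 'rV[R]_n -> 'M[R]_n) (f : 'rV[R]_n -> 'rV[R]_(n + n)).
Variables (H : 'rV[R]_(n + n) -> 'M[R]_(n + n)) (B C : R -> R) (x : 'rV[R]_n).
Let s y := rsubmx (f y).
Let S y := form (g y) (s y) (s y).

(* The connection map: the fibre component of [u] in [T_z TM]. *)
Definition vertical (z u : 'rV[R]_(n + n)) : 'rV[R]_n :=
  rsubmx u + Gamma g (lsubmx z) (lsubmx u) (rsubmx z).

(** The Kaluza-Klein metric in induced coordinates, with [A = 1] built in as the coefficient of the
    horizontal term. Being pointwise in [z], it can be imposed just along the section and along one
    line in the fibre, with [B] and [C] replaced by extensions that agree with them on the
    half-line. *)
Definition kk_at (z : 'rV[R]_(n + n)) :=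
  let gz := form (g (lsubmx z)) in
  let e := rsubmx z in
  forall u v, form (H z) u v =
    gz (lsubmx u) (lsubmx v) + B (gz e e) * gz (vertical z u) (vertical z v)
    + C (gz e e) * gz (vertical z u) e * gz (vertical z v) e.

Hypothesis openU : open U.
Hypothesis Ux : U x.
Hypothesis symg : forall x, U x -> (g x)^T = g x.
Hypothesis unitg : forall x, U x -> g x \in unitmx.
Hypothesis diffg : forall x, U x -> differentiable g x.
Hypothesis sectionf : forall y, U y -> lsubmx (f y) = y.
Hypothesis difff : forall y, U y -> differentiable f y.
Hypothesis diff2f : forall j, differentiable (partial j f) x.
Hypothesis diffS : differentiable S x.
Hypothesis diff2S : forall w, derivable ('D_w S) x w.
Hypothesis diffH : differentiable H (f x).
Hypothesis symH : (H (f x))^T = H (f x).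
Hypothesis unitH : H (f x) \in unitmx.
Hypothesis kk_section : forall y, U y -> kk_at (f y).
Hypothesis kk_scaled : forall t : R, kk_at (t *: row_mx 0 (s x) + f x).
Variables (dB dC : R).
Hypothesis derB : is_derive (S x) 1 B dB.
Hypothesis derC : is_derive (S x) 1 C dC.

Lemma vertical_row0 z v : vertical z (row_mx 0 v) = v.
Proof. by rewrite /vertical row_mxKl row_mxKr Gamma0l addr0. Qed.

Lemma lsubmx_derive y w : U y -> lsubmx ('D_w f y) = w.
Proof.
move=> Uy; have h := is_derive_fst (is_derive_diff w (difff Uy)).
case: h => _ <-; rewrite -[RHS](derive_id y w).
apply: near_eq_derive.
by apply: filterS (open_nbhs_nbhs (conj openU Uy)) => u Uu; exact: sectionf.
Qed.

Lemma deriveS y w : U y ->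
  is_derive y w S (2 * form (g y) (vertical (f y) ('D_w f y)) (s y)).
Proof.
move=> Uy; apply: is_derive_eq.
  apply: (derive_sqnorm openU symg unitg diffg Uy (s := s)).
  exact: is_derive_snd (is_derive_diff w (difff Uy)).
by rewrite /vertical sectionf // lsubmx_derive.
Qed.

(* Differentiating this identity along [w] yields the term [D_U H (U, V)] of the
   Koszul formula for [H] without any derivative of the Christoffel symbols. *)
Lemma kk_radial y w : U y ->
  form (H (f y)) ('D_w f y) (row_mx 0 (s y)) =
  (B (S y) + S y * C (S y)) * (2^-1 * 'D_w S y).
Proof.
move=> Uy; have [_ ->] := deriveS w Uy.
rewrite kk_section // vertical_row0 row_mxKl form0r sectionf // -/(s y) -/(S y).
by field.
Qed.

(** Along [t *: (0, s x) + f x] the base point is fixed and the fibre coordinate is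
    [(1 + t) *: s x]. The squared norm becomes [(1 + t)^2 * S x], the vertical part of the fixed
    vector ['D_w f x] becomes [k + t *: ga], and the horizontal term is constant. Differentiate at
    [t = 0]. *)
Lemma vertical_metric_derive w :
  let k := vertical (f x) ('D_w f x) in
  let gk := form (g x) k in
  let ga := Gamma g x w (s x) in
  form ('D_(row_mx 0 (s x)) H (f x)) ('D_w f x) ('D_w f x) =
  2 * (S x * dB * gk k + B (S x) * gk ga + S x * dC * gk (s x) ^+ 2
       + C (S x) * gk (s x) * (gk (s x) + form (g x) ga (s x))).
Proof.
move=> k gk ga; set W := row_mx 0 (s x).
have d0 : is_derive (0 : R) 1 (fun t : R => form (H (t *: W + f x)) ('D_w f x) ('D_w f x))
    (form ('D_W H (f x)) ('D_w f x) ('D_w f x)).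
  have h : is_derive (0 *: W + f x) W (fun z => form (H z) ('D_w f x) ('D_w f x))
     (form ('D_W H (f x)) ('D_w f x) ('D_w f x)).
    rewrite scale0r add0r.
    apply: is_derive_eq (is_derive_form (is_derive_diff W diffH)
      (is_derive_cst _ _ _) (is_derive_cst _ _ _)) _.
    by rewrite form0l form0r !addr0.
  exact: is_derive_line h.
pose q t := (1 + t) * ((1 + t) * S x).
pose gs := form (g x) ga (s x).
have e t : form (H (t *: W + f x)) ('D_w f x) ('D_w f x) =
   form (g x) w w + B (q t) * (gk k + t * (2 * gk ga + t * form (g x) ga ga))
   + C (q t) * (((1 + t) * (gk (s x) + t * gs)) * ((1 + t) * (gk (s x) + t * gs))).
  rewrite kk_scaled.
  have -> : lsubmx (t *: W + f x) = x.
    by rewrite linearD linearZ /= row_mxKl scaler0 add0r sectionf.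
  have es : rsubmx (t *: W + f x) = (1 + t) *: s x.
    by rewrite linearD linearZ /= row_mxKr addrC scalerDl scale1r.
  have -> : vertical (t *: W + f x) ('D_w f x) = k + t *: ga.
    rewrite /k /vertical es linearD linearZ /= row_mxKl scaler0 add0r sectionf //.
    by rewrite lsubmx_derive // GammaZr scalerDl scale1r addrA.
  rewrite es lsubmx_derive // !(formZl, formZr) -/(S x) -/(q t) /gk /gs.
  clearbody k ga; rewrite !(formDl, formDr) !(formZl, formZr).
  by rewrite (formC ga k (symg Ux)); ring.
have h1 : is_derive (0 : R) 1 (fun t : R => 1 + t) 1.
  by apply: is_derive_eq (is_derive_add (is_derive_cst (1 : R) _ _) (is_derive_id _ _)) _;
    rewrite add0r.
have hc (c : R) := is_derive_cst c (0 : R) (1 : R).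
have hq : is_derive (0 : R) 1 q (2 * S x).
  apply: is_derive_eq (is_derive_mul h1 (is_derive_mul h1 (hc (S x)))) _.
  by rewrite /cst; ring.
have hq0 : q 0 = S x by rewrite /q addr0 !mul1r.
have hcomp (h : R -> R) dh : is_derive (S x) 1 h dh ->
    is_derive (0 : R) 1 (fun t => h (q t)) (dh * (2 * S x)).
  move=> hd; case: (hq) => hq1 hq2; rewrite -[in X in _ * X]hq2.
  apply: is_derive_comp1; last by rewrite hq0.
  exact/derivable1_diffP.
have hid := is_derive_id (0 : R) (1 : R).
have hp (a b : R) := is_derive_add (hc a) (is_derive_mul hid (hc b)).
have hr := is_derive_mul h1 (hp (gk (s x)) gs).
have hu := is_derive_add (hc (gk k)) (is_derive_mul hid (hp (2 * gk ga) (form (g x) ga ga))).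
have := is_derive_add (is_derive_add (hc (form (g x) w w))
  (is_derive_mul (hcomp _ _ derB) hu)) (is_derive_mul (hcomp _ _ derC) (is_derive_mul hr hr)).
rewrite /cst /= => hphi.
have e' : (fun t : R => form (H (t *: W + f x)) ('D_w f x) ('D_w f x)) = _ := funext e.
move: d0; rewrite e' => -[_ <-]; case: hphi => _ ->.
by rewrite hq0 -/gs; ring.
Qed.

Lemma kk_section_mixed w v :
  form (H (f x)) ('D_w f x) (row_mx 0 v) =
  B (S x) * form (g x) (vertical (f x) ('D_w f x)) v +
  C (S x) * form (g x) (vertical (f x) ('D_w f x)) (s x) * form (g x) v (s x).
Proof.
by rewrite kk_section // vertical_row0 row_mxKl form0r sectionf // add0r.
Qed.

(** Here [k] is the covariant derivative of the field along [w]. With [U = 'D_w f x] and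
    [V = (0, s x)], Koszul gives [H(Gamma(U, U), V) = D_U H(U, V) - D_V H(U, U) / 2]. The last term
    is [vertical_metric_derive]. The other one, together with [H('D_w ('D_w f) x, V)], is found by
    differentiating [H(U, V)] in two ways: through [kk_radial] ([h1]) and by the product rule
    ([h2]). *)
Lemma directional_tension w :
  let k := vertical (f x) ('D_w f x) in
  form (H (f x)) ('D_w ('D_w f) x - 'D_(Gamma g x w w) f x
    + Gamma H (f x) ('D_w f x) ('D_w f x)) (row_mx 0 (s x)) =
  (B (S x) + S x * C (S x)) *
     (2^-1 * ('D_w ('D_w S) x - 'D_(Gamma g x w w) S x))
  + (2 * dB + S x * dC) * (2^-1 * 'D_w S x) ^+ 2
  - (B (S x) + S x * dB) * form (g x) k k.
Proof.
move=> k.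
have diff1f v := is_derive_diff v (difff Ux).
pose P y := B (S y) + S y * C (S y).
have hS := is_derive_diff w diffS.
have hP : is_derive x w P ((dB + C (S x) + S x * dC) * 'D_w S x).
  apply: is_derive_eq (is_derive_add (is_derive_comp1 w diffS derB)
    (is_derive_mul hS (is_derive_comp1 w diffS derC))) _.
  ring.
have h1 : is_derive x w
    (fun y => form (H (f y)) ('D_w f y) (row_mx 0 (s y)))
    ((dB + C (S x) + S x * dC) * 'D_w S x * (2^-1 * 'D_w S x)
      + P x * (2^-1 * 'D_w ('D_w S) x)).
  apply: (@near_eq_is_derive _ _ _ (fun y => P y * (2^-1 * 'D_w S y))).
    apply: filterS (open_nbhs_nbhs (conj openU Ux)) => y Uy.
    by rewrite kk_radial.
  have ddS : derivable ('D_w S) x w by exact: diff2S.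
  have := is_derive_mul hP (is_derive_mul (is_derive_cst (2^-1 : R) x w)
    (derivableP ddS)).
  by rewrite mul0r add0r.
have h2 : is_derive x w
    (fun y => form (H (f y)) ('D_w f y) (row_mx 0 (s y)))
    (form ('D_('D_w f x) H (f x)) ('D_w f x) (row_mx 0 (s x))
     + form (H (f x)) ('D_w ('D_w f) x) (row_mx 0 (s x))
     + form (H (f x)) ('D_w f x) (row_mx 0 (rsubmx ('D_w f x)))).
  apply: is_derive_form.
  - have := is_derive_diff w (differentiable_comp (difff Ux) diffH).
    by rewrite (derive_comp w (difff Ux) diffH).
  - apply: derivableP; case: (@is_derive2_partial R n _ f x w) => //.
    exact: filterS (open_nbhs_nbhs (conj openU Ux)).
  - have /is_derive_mxP hs := is_derive_snd (diff1f w).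
    apply/is_derive_mxP => i j; case: (split_ordP j) => l ->.
      rewrite row_mxEl mxE; under eq_fun do rewrite row_mxEl mxE.
      exact: is_derive_cst.
    by rewrite row_mxEr; under eq_fun do rewrite row_mxEr; exact: hs.
case: h1 => _ h1; case: h2 => _ h2.
have /esym e12 := etrans (etrans (esym h1) h2) (congr1 (fun m => _ + m)
  (kk_section_mixed w (rsubmx ('D_w f x)))).
rewrite -/k in e12.
have rad v : form (H (f x)) ('D_v f x) (row_mx 0 (s x)) = P x * (2^-1 * 'D_v S x).
  exact: kk_radial.
rewrite formDl formDl formNl rad koszul //.
rewrite (vertical_metric_derive w) -/k.
(* The coordinate derivative of the field differs from the covariant one by a Christoffel term; it
   cancels against the [ga] terms of [vertical_metric_derive], leaving a tensorial formula. *)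
have kE : rsubmx ('D_w f x) = k - Gamma g x w (s x).
  by rewrite /k /vertical sectionf // lsubmx_derive // addrK.
have [_ e3] := deriveS w Ux.
move: e12; rewrite kE formDr formNr formDl formNl e3 -/k /P.
set X1 := form ('D_('D_w f x) H (f x)) _ _.
set X2 := form (H (f x)) _ _.
move=> e12.
have -> : X2 = (dB + C (S x) + S x * dC) * (2 * form (g x) k (s x)) * (2^-1 * (2 * form (g x) k (s x)))
      + (B (S x) + S x * C (S x)) * (2^-1 * 'D_w ('D_w S) x) - X1 -
      (B (S x) * (form (g x) k k - form (g x) k (Gamma g x w (s x))) +
       C (S x) * form (g x) k (s x) *
       (form (g x) k (s x) - form (g x) (Gamma g x w (s x)) (s x))).
  by rewrite -e12; ring.
by field.
Qed.

Variable Q : 'M[R]_n.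
Hypothesis unitQ : Q \in unitmx.
Hypothesis frameQ : invmx (g x) = Q^T *m Q.

Lemma tension_frame : tension_coord g H f x = \sum_k
  ('D_(row k Q) ('D_(row k Q) f) x
   - 'D_(Gamma g x (row k Q) (row k Q)) f x
   + Gamma H (f x) ('D_(row k Q) f x) ('D_(row k Q) f x)).
Proof.
rewrite /tension_coord (trace_frame _ frameQ); apply: eq_bigr => k _.
set w := row k Q; have df := difff Ux.
have [|_ ->] := is_derive2_partial w _ diff2f.
  exact: filterS (open_nbhs_nbhs (conj openU Ux)).
rewrite (derive_partial w df) Gamma_sum (derive_partial _ df).
under eq_bigr do under eq_bigr do rewrite scalerDr scalerBr.
under eq_bigr do rewrite big_split sumrB /=.
rewrite big_split sumrB /=; congr (_ - _ + _).
transitivity (\sum_i \sum_j \sum_l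
    ((w 0 i * w 0 j) * christoffel g x i j l) *: partial l f x).
  apply: eq_bigr => i _; apply: eq_bigr => j _; rewrite scaler_sumr.
  by apply: eq_bigr => l _; rewrite scalerA.
rewrite sum_rotate; apply: eq_bigr => l _.
rewrite mxE scaler_suml; apply: eq_bigr => i _.
by rewrite scaler_suml; apply: eq_bigr => j _; congr (_ *: _); ring.
Qed.

(** The Laplace-Beltrami operator of [g] on [S = |sigma|^2] at [x], as the trace of the Hessian;
    [frame_energy] and [frame_gradient] below are [|nabla sigma|^2] and [|d(S/2)|^2]. *)
Definition frame_laplacian : R := \sum_k
  ('D_(row k Q) ('D_(row k Q) S) x - 'D_(Gamma g x (row k Q) (row k Q)) S x).

Definition frame_energy : R := \sum_k
  form (g x) (vertical (f x) ('D_(row k Q) f x))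
             (vertical (f x) ('D_(row k Q) f x)).

Definition frame_gradient : R := \sum_k (2^-1 * 'D_(row k Q) S x) ^+ 2.

Lemma tension_radial :
  form (H (f x)) (tension_coord g H f x) (row_mx 0 (s x)) =
  (B (S x) + S x * C (S x)) * (2^-1 * frame_laplacian)
  + (2 * dB + S x * dC) * frame_gradient
  - (B (S x) + S x * dB) * frame_energy.
Proof.
rewrite tension_frame form_suml /frame_laplacian /frame_gradient /frame_energy.
rewrite !mulr_sumr -big_split -sumrB; apply: eq_bigr => k _.
exact: directional_tension.
Qed.

Hypothesis posg : positive_form (g x).
Hypothesis posH : positive_form (H (f x)).
Hypothesis harmonic : form (H (f x)) (tension_coord g H f x) (row_mx 0 (s x)) = 0.
Hypothesis cond1 : 0 <= 2 * dB + S x * dC.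
Hypothesis cond2 : - B (S x) + S x * dB + S x ^+ 2 * dC <= 0.

Lemma frame_gradient_le : frame_gradient <= S x * frame_energy.
Proof.
rewrite /frame_energy mulr_sumr; apply: ler_sum => k _.
have [_ ->] := deriveS (row k Q) Ux; rewrite mulKf ?pnatr_eq0 //.
by rewrite mulrC; apply: form_cauchy_schwarz => //; exact: symg.
Qed.

Lemma frame_energy_ge0 : 0 <= frame_energy.
Proof. by apply: sumr_ge0 => k _; exact: positive_form_ge0. Qed.

(** Where [s x] is nonzero, [H] on its own vertical lift equals [S x] times this factor. At a zero
    of the field the factor is [B 0], whose sign is seen on the vertical lift of [u]. *)
Lemma radial_factor_gt0 (u : 'rV[R]_n) : u != 0 -> 0 < B (S x) + S x * C (S x).
Proof.
move=> u0; have row0 v : v != 0 -> row_mx (0 : 'rV[R]_n) v != 0.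
  by apply: contra => /eqP e; rewrite -(row_mxKr (0 : 'rV[R]_n) v) e linear0.
have Hv v : v != 0 -> 0 < B (S x) * form (g x) v v
    + C (S x) * form (g x) v (s x) ^+ 2.
  move=> /row0 /posH; rewrite kk_section // vertical_row0 row_mxKl form0r add0r.
  by rewrite sectionf // -/(s x) -/(S x) expr2 mulrA.
have [s0|/[dup] s0 /posg S0] := eqVneq (s x) 0.
  have Sx0 : S x = 0 by rewrite /S s0 form0l.
  have := Hv u u0; rewrite s0 form0r expr0n mulr0 addr0 Sx0 mul0r addr0.
  by rewrite pmulr_lgt0 // posg.
rewrite -(pmulr_lgt0 _ S0) /S mulrDl; have := Hv _ s0.
by rewrite expr2; congr (0 < _ + _); ring.
Qed.

(** By [cond1] the gradient in [tension_radial] may be replaced by its bound [S x * frame_energy].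
    The energy then has coefficient [B - S B' - S^2 C'], which is nonnegative by [cond2]. *)
Lemma frame_laplacian_ge0 : 0 <= frame_laplacian.
Proof.
(* In dimension zero no nonzero vector witnesses the positivity of the radial factor, but then every
   directional derivative is zero. *)
have [[u u0]|no] := pselect (exists u : 'rV[R]_n, u != 0); last first.
  apply: sumr_ge0 => k _.
  have r0 (u : 'rV[R]_n) : u = 0.
    by apply/eqP; apply: contrapT => /negP u0; apply: no; exists u.
  by rewrite !(r0 (row k Q)) (r0 (Gamma g x 0 0)) !derive0 subrr.
have P0 := radial_factor_gt0 u0.
have := harmonic; rewrite tension_radial => e.
have le1 := ler_wpM2l cond1 frame_gradient_le.
have le2 : 0 <= (B (S x) - S x * dB - S x ^+ 2 * dC) * frame_energy.
  rewrite mulr_ge0 ?frame_energy_ge0 // -oppr_le0.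
  by move: cond2; congr (_ <= 0); ring.
rewrite -(pmulr_rge0 _ P0).
suff -> : (B (S x) + S x * C (S x)) * frame_laplacian =
  2 * ((B (S x) - S x * dB - S x ^+ 2 * dC) * frame_energy
  + ((2 * dB + S x * dC) * (S x * frame_energy)
     - (2 * dB + S x * dC) * frame_gradient)).
  by rewrite mulr_ge0 // addr_ge0 // subr_ge0.
have -> : (B (S x) + S x * C (S x)) * frame_laplacian =
  2 * ((B (S x) + S x * C (S x)) * (2^-1 * frame_laplacian)) by field.
have -> : (B (S x) + S x * C (S x)) * (2^-1 * frame_laplacian) =
  (B (S x) + S x * dB) * frame_energy - (2 * dB + S x * dC) * frame_gradient.
  by move/eqP: e; rewrite subr_eq0 => /eqP <-; rewrite addrK.
by ring.
Qed.

(** Only [(B + S B') * frame_energy = 0] survives in [tension_radial]. So the covariant derivative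
    vanishes along each frame vector, and the rows of the invertible [Q] span all directions. *)
Lemma parallel_of_constant_norm (u : 'rV[R]_n) : (forall w, 'D_w S x = 0) ->
  frame_laplacian = 0 -> B (S x) + S x * dB != 0 ->
  vertical (f x) ('D_u f x) = 0.
Proof.
move=> dS0 lap0 nz.
have grad0 : frame_gradient = 0.
  by apply: big1 => k _; rewrite dS0 mulr0 expr0n.
have := harmonic; rewrite tension_radial lap0 grad0 !mulr0 add0r sub0r.
move=> /eqP; rewrite oppr_eq0 mulf_eq0 (negPf nz) /= => /eqP en0.
have vk k : vertical (f x) ('D_(row k Q) f x) = 0.
  apply/eqP; apply/negPn/negP => /posg vk0; move: en0; rewrite /frame_energy.
  rewrite (bigD1 k) //= => h.
  have : 0 <= \sum_(i < n | i != k)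
     form (g x) (vertical (f x) ('D_(row i Q) f x))
                (vertical (f x) ('D_(row i Q) f x)).
    by apply: sumr_ge0 => i _; exact: positive_form_ge0.
  by lra.
pose phi v := vertical (f x) ('D_v f x).
have lin c v w : phi (c *: v + w) = c *: phi v + phi w.
  rewrite /phi derive_lin ?difff //; last exact: difff.
  rewrite /vertical !linearP /= GammaDl GammaZl scalerDr.
  exact: addrACA.
have l0 : phi 0 = 0.
  by rewrite /phi derive0 /vertical !linear0 Gamma0l addr0.
have phiD v w : phi (v + w) = phi v + phi w.
  by rewrite -{1}[v]scale1r lin scale1r.
rewrite -[LHS]/(phi u).
have {}vk k : phi (row k Q) = 0 by exact: vk.
clearbody phi; rewrite -[u](mulmxKV unitQ) mulmx_sum_row.
rewrite (big_morph phi phiD l0) big1 // => k _.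
by rewrite -[X in phi X]addr0 lin l0 addr0 vk scaler0.
Qed.

End VerticalTension.

(** * Smoothness of the coefficients *)

Section LocalDifferentiability.
Variables (R : realType) (V W : normedModType R).

Lemma near_eq_differentiable (f h : V -> W) x :
  (\forall y \near x, f y = h y) -> differentiable f x -> differentiable h x.
Proof.
move=> fh df.
have fhx : f x = h x by exact: nbhs_singleton fh.
have hx : h \o shift x = cst (h x) + 'd f x +o_ 0 id.
  have /diff_locallyP [_ hf] := df.
  apply/eqaddoP => e e0; move/eqaddoP: hf => /(_ e e0) hf.
  have fh0 : \forall y \near (0 : V), f (y + x) = h (y + x).
    by move: fh; rewrite (near_shift 0); apply: filterS => y; rewrite /= subr0.
  apply: filterS2 hf fh0 => y hy e1; move: hy.
  by rewrite -![(_ - _ : _ -> _) _]/(_ - _) -![(_ + _ : _ -> _) _]/(_ + _) /= e1 /cst fhx.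
have dfc : continuous ('d f x) by exact: diff_continuous.
by apply/diff_locallyP; rewrite (diff_unique dfc hx).
Qed.

Lemma differentiable_entry m n (M : V -> 'M[R]_(m, n)) x i j :
  differentiable M x -> differentiable (fun y => M y i j) x.
Proof.
move=> dM; exact: (differentiable_comp dM (differentiable_coord _ _ _)).
Qed.

Lemma differentiable_form n (g : V -> 'M[R]_n) (u v : V -> 'rV[R]_n) x :
  differentiable g x -> differentiable u x -> differentiable v x ->
  differentiable (fun y => form (g y) (u y) (v y)) x.
Proof.
move=> dg du dv.
have -> : (fun y => form (g y) (u y) (v y)) =
    \sum_i \sum_j (((fun y => u y 0 i) * (fun y => v y 0 j)) * (fun y => g y i j)).
  apply/funext => y; rewrite formE fct_sumE; apply: eq_bigr => i _.
  by rewrite fct_sumE.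
apply: differentiable_sum => i; apply: differentiable_sum => j.
by do 2?apply: differentiableM; exact: differentiable_entry.
Qed.

End LocalDifferentiability.

Section SmoothNorm.
Variables (R : realType) (n : nat) (U : set 'rV[R]_n).
Variables (g : 'rV[R]_n -> 'M[R]_n) (s : 'rV[R]_n -> 'rV[R]_n).
Hypothesis openU : open U.
Hypothesis diffg : forall x, U x -> differentiable g x.
Hypothesis diff2g : forall x j, U x -> differentiable (partial j g) x.
Hypothesis diffs : forall x, U x -> differentiable s x.
Hypothesis diff2s : forall x j, U x -> differentiable (partial j s) x.

Lemma differentiable2_form x j : U x ->
  differentiable (partial j (fun y => form (g y) (s y) (s y))) x.
Proof.
move=> Ux; apply: (@near_eq_differentiable _ _ _ (fun y =>
   form (partial j g y) (s y) (s y) + form (g y) (partial j s y) (s y)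
   + form (g y) (s y) (partial j s y))).
  apply: filterS (open_nbhs_nbhs (conj openU Ux)) => y Uy.
  have dg := is_derive_diff (delta_mx 0 j) (diffg Uy).
  have ds := is_derive_diff (delta_mx 0 j) (diffs Uy).
  by case: (is_derive_form dg ds ds) => _ <-.
by do 2?apply: differentiableD; apply: differentiable_form; auto.
Qed.

End SmoothNorm.

Section CoefficientLimits.
Variables (R : realType) (T : Type) (F : set_system T).
Hypothesis FF : Filter F.

Lemma cvg_det n (A : T -> 'M[R]_n) (lA : 'M[R]_n) :
  (forall i j, A y i j @[y --> F] --> lA i j) ->
  \det (A y) @[y --> F] --> \det lA.
Proof.
move=> hA; apply: cvg_sumr => p.
by apply: cvgM; [exact: cvg_cst|apply: cvg_prodr => i; exact: hA].
Qed.

(** Cramer's formula. It is used only where [A y] is invertible, since [invmx] returns a singular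
    matrix unchanged. *)
Lemma cvg_invmx n (A : T -> 'M[R]_n) (lA : 'M[R]_n) :
  (\forall y \near F, A y \in unitmx) -> lA \in unitmx ->
  (forall i j, A y i j @[y --> F] --> lA i j) ->
  forall i j, invmx (A y) i j @[y --> F] --> invmx lA i j.
Proof.
move=> uA ulA hA i j.
have e (B : 'M[R]_n) : B \in unitmx -> (\det B)^-1 * cofactor B j i = invmx B i j.
  by move=> uB; rewrite /invmx uB !mxE.
rewrite -(e _ ulA).
apply: (@cvg_trans _ ((\det (A y))^-1 * cofactor (A y) j i @[y --> F])).
  by apply: near_eq_cvg; apply: filterS uA => y; exact: e.
apply: cvgM.
  apply: cvgV; last exact: cvg_det.
  by move: ulA; rewrite unitmxE unitfE.
apply: cvgM; first exact: cvg_cst.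
apply: cvg_det => k l; rewrite !mxE.
by under eq_fun do rewrite !mxE; exact: hA.
Qed.

End CoefficientLimits.

(** * Harmonic sections in a chart *)

Section Charts.
Variables (R : realType) (n : nat) (M : Type) (D : charts R n M).
Implicit Types (i j : chart D) (p q : M).

(** Valid without injectivity of the coordinates, at the price of an unspecified point [q]. This
    form is applied to the induced charts of the tangent bundle, for which no atlas property is
    established. *)
Lemma read_in_coord (W : normedModType R) i (F : M -> W) p : dom i p ->
  exists q, [/\ dom i q, coord i q = coord i p & read_in i F (coord i p) = F q].
Proof.
move=> dp; have [|q [dq cq] Fq] := @xgetPex _ (0 : W)
    [set F q | q in [set q | dom i q /\ coord i q = coord i p]].
  by exists (F p), p.
by exists q; split => //; exact/esym.
Qed.

Hypothesis atlasD : smooth_atlas D.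

Lemma read_inE (W : normedModType R) i (F : M -> W) p : dom i p ->
  read_in i F (coord i p) = F p.
Proof.
move=> dp; have [q [dq cq ->]] := read_in_coord F dp.
by have [_ inj _ _] := atlasD; rewrite (inj i q p).
Qed.

Lemma transition_differentiable i j p : dom i p -> dom j p ->
  differentiable (transition i j) (coord i p).
Proof.
move=> dip djp; have [_ _ _ sm] := atlasD; have [+ _] := sm i j 1%N.
by move=> /(_ [::] (coord i p) isT); apply; exists p.
Qed.

(** Differentials of transition maps are linear, so scaled components are again compatible. It
    supplies actual tangent vectors along the fibre line of [kk_scaled]. *)
Lemma tangent_scale (c : R) (e : tangent D) : exists2 e' : tangent D,
  foot e' = foot e & forall i, tcomp e' i = c *: tcomp e i.
Proof.
have out i : ~ dom i (foot e) -> c *: tcomp e i = 0.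
  by move=> /tcomp_out ->; rewrite scaler0.
have tr i j : dom i (foot e) -> dom j (foot e) ->
    c *: tcomp e j = 'D_(c *: tcomp e i) (transition i j) (coord i (foot e)).
  move=> di dj; rewrite (tcomp_transition di dj) -[in RHS](addr0 (c *: _)).
  by rewrite derive_lin ?derive0 ?addr0 //; exact: transition_differentiable.
by exists (Tangent out tr).
Qed.

Lemma sqnormE (g : tensor2 D) k (e : tangent D) i :
  riemannian_metric_of_class k g -> dom i (foot e) ->
  sqnorm g e = form (g i (foot e)) (tcomp e i) (tcomp e i).
Proof.
move=> [_ _ inv _] di; apply: xget_unique; first by exists i.
move=> _ [j dj <-]; rewrite (inv i j) //.
by rewrite -(tcomp_transition di dj).
Qed.

Lemma image_overlap i : coord i @` dom i = overlap i i.
Proof. by rewrite /overlap setIid. Qed.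

End Charts.

Lemma smooth_onP (R : realType) n (W : normedModType R) (U : set 'rV[R]_n)
    (f : 'rV[R]_n -> W) x : smooth_on U f -> U x ->
  differentiable f x /\ forall j, differentiable (partial j f) x.
Proof.
move=> sf Ux; split=> [|j]; first by have [+ _] := sf 1%N; move/(_ [::] x isT Ux).
by have [+ _] := sf 2%N; move/(_ [:: delta_mx 0 j] x isT Ux).
Qed.

Section HarmonicSection.
Variables (R : realType) (n : nat) (M : topologicalType) (D : charts R n M).
Variables (g : tensor2 D) (B C A : R -> R) (G : tensor2 (tangent_charts D)).
Variable sigma : M -> tangent D.
Hypothesis hM : smooth_manifold D.
Hypothesis hg : riemannian_metric g.
Hypothesis hG : kaluza_klein g A B C G.
Hypothesis hA : forall t, 0 <= t -> A t = 1.
Hypothesis hsigma : vector_field sigma.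

Section InChart.
Variable i : chart D.

Let ti : chart (tangent_charts D) := i.
Let U := coord i @` dom i.
Let gi := read_in i (g i).
Let Hi := read_in ti (G ti).
Let fi := read_in i (coord ti \o sigma).
Let si y := rsubmx (fi y).
Let Si y := form (gi y) (si y) (si y).

Lemma atlas_of : smooth_atlas D. Proof. by case: hM. Qed.

Lemma open_chart_image : open U.
Proof. by have [[_ _ h _] _ _ _ _] := hM; rewrite /U image_overlap. Qed.

Lemma foot_sigma p : foot (sigma p) = p. Proof. by case: hsigma. Qed.

Lemma metric_chart p : dom i p -> gi (coord i p) = g i p.
Proof. by move=> dp; exact: (read_inE atlas_of (g i) dp). Qed.

Lemma section_chart p : dom i p ->
  fi (coord i p) = row_mx (coord i p) (tcomp (sigma p) i).
Proof. by move=> dp; rewrite /fi (read_inE atlas_of) //= foot_sigma. Qed.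

Lemma field_chart p : dom i p -> si (coord i p) = tcomp (sigma p) i.
Proof. by move=> dp; rewrite /si section_chart // row_mxKr. Qed.

Lemma sqnorm_chart p : dom i p -> Si (coord i p) = sqnorm g (sigma p).
Proof.
move=> dp; rewrite (sqnormE (hg 0) (i := i)) ?foot_sigma //.
by rewrite /Si metric_chart // field_chart.
Qed.

Lemma metric_smooth x : U x ->
  differentiable gi x /\ forall j, differentiable (partial j gi) x.
Proof. by move=> Ux; apply: (smooth_onP _ Ux) => k; have [_ _ _] := hg k; exact. Qed.

Lemma section_smooth x : U x ->
  differentiable fi x /\ forall j, differentiable (partial j fi) x.
Proof.
move=> Ux; apply: (smooth_onP _ Ux); have [_ /(_ i ti) [_]] := hsigma.
rewrite (_ : _ `&` _ = dom i) //; apply/seteqP; split=> p; first by case.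
by move=> dp; split => //=; rewrite foot_sigma.
Qed.

Lemma metric_sym x : U x -> (gi x)^T = gi x.
Proof.
by move=> [p dp <-]; rewrite metric_chart //; have [h _ _ _] := hg 0; exact: h.
Qed.

Lemma metric_pos x : U x -> positive_form (gi x).
Proof.
move=> [p dp <-] u u0; rewrite metric_chart //.
by have [_ h _ _] := hg 0; exact: h.
Qed.

Lemma metric_frame x : U x -> exists Q : 'M[R]_n,
  [/\ Q \in unitmx, gi x \in unitmx & invmx (gi x) = Q^T *m Q].
Proof.
move=> Ux; have [Q [_ h1 h2 h3]] := orthonormal_frame (metric_sym Ux) (metric_pos Ux).
by exists Q.
Qed.

Lemma metric_unit x : U x -> gi x \in unitmx.
Proof. by move=> /metric_frame[Q []]. Qed.

Lemma lsubmx_section x : U x -> lsubmx (fi x) = x.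
Proof. by move=> [p dp <-]; rewrite section_chart // row_mxKl. Qed.

Lemma field_smooth x : U x ->
  differentiable si x /\ forall j, differentiable (partial j si) x.
Proof.
move=> Ux; have [df ddf] := section_smooth Ux; split=> [|j].
  exact: differentiable_comp df (differentiable_rsubmx _).
apply: (@near_eq_differentiable _ _ _ (fun y => rsubmx (partial j fi y))).
  apply: filterS (open_nbhs_nbhs (conj open_chart_image Ux)) => y Uy.
  have [dfy _] := section_smooth Uy.
  by case: (is_derive_snd (is_derive_diff (delta_mx 0 j) dfy)) => _ /esym.
exact: differentiable_comp (ddf j) (differentiable_rsubmx _).
Qed.

Lemma sqnorm_smooth x : U x ->
  differentiable Si x /\ forall j, differentiable (partial j Si) x.
Proof.
move=> Ux; split=> [|j].
  have [dg _] := metric_smooth Ux; have [ds _] := field_smooth Ux.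
  exact: differentiable_form.
have dg y : U y -> differentiable gi y by case/metric_smooth.
have ddg y k : U y -> differentiable (partial k gi) y by case/metric_smooth.
have ds y : U y -> differentiable si y by case/field_smooth.
have dds y k : U y -> differentiable (partial k si) y by case/field_smooth.
exact: (differentiable2_form open_chart_image dg ddg ds dds).
Qed.

(** [e'] shares with [e] its foot and its components in the chart [i], and the Kaluza-Klein formulas
    in that chart depend on nothing else. *)
Lemma lift_chart (e : tangent D) : dom i (foot e) -> exists e' : tangent D,
  [/\ dom i (foot e'), foot e' = foot e, tcomp e' i = tcomp e i
    & Hi (row_mx (coord i (foot e)) (tcomp e i)) = G ti e'].
Proof.
move=> de.
have [e' [/= de' ee' hH]] := @read_in_coord R (n + n) _ (tangent_charts D) _ ti (G ti) e de.
exists e'; move/eq_row_mx : ee' => [cf ct]; split => //.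
by have [_ inj _ _] := atlas_of; exact: (inj i).
Qed.

Lemma lift_metric_sym (e : tangent D) : dom i (foot e) -> (G ti e)^T = G ti e.
Proof. by move=> de; have [_ _ [h _ _ _] _] := hG; exact: h. Qed.

(** Splitting [u] and [v] into lifts reduces this to the clauses of [kaluza_klein]; the mixed terms
    vanish and [hA] gives the coefficient [1]. The functions are evaluated at a squared norm only,
    so agreement on the half-line suffices. *)
Lemma kk_chart (B' C' : R -> R) (e : tangent D) :
  (forall t, 0 <= t -> B' t = B t) -> (forall t, 0 <= t -> C' t = C t) ->
  dom i (foot e) -> kk_at gi Hi B' C' (row_mx (coord i (foot e)) (tcomp e i)).
Proof.
move=> eB eC de gz y u v; rewrite {}/gz {}/y /vertical !row_mxKl !row_mxKr.
have [e' [de' fe' te' ->]] := lift_chart de.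
have Ue : U (coord i (foot e)) by exists (foot e).
have s0 := positive_form_ge0 (tcomp e i) (metric_pos Ue).
rewrite eB // eC //; move: s0; rewrite metric_chart //.
have -> : form (g i (foot e)) (tcomp e i) (tcomp e i) = sqnorm g e'.
  by rewrite (sqnormE (hg 0) de') fe' te'.
move=> s0; have [_ _ _ kk] := hG.
have [E1 E2 E3] : 
  [/\ forall a b, form (G ti e') (hlift g i e' a) (hlift g i e' b) =
     form (g i (foot e)) a b,
   forall a b, form (G ti e') (hlift g i e' a) (vlift b) = 0 &
   forall a b, form (G ti e') (vlift a) (vlift b) =
     B (sqnorm g e') * form (g i (foot e)) a b + C (sqnorm g e') *
       form (g i (foot e)) a (tcomp e i) * form (g i (foot e)) b (tcomp e i)].
  split=> a b; have := kk i e' a b de'; rewrite fe' te' => -[h1 h2 h3] //.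
  by rewrite h1 hA // mul1r.
rewrite (hpart_vpartE g i e' u) (hpart_vpartE g i e' v).
rewrite [LHS]formDl 2!formDr E1 E2 E3.
rewrite (formC _ _ (lift_metric_sym de')) E2 addr0 add0r.
rewrite -!hpart_vpartE /vpart /hpart /chart_Gamma fe' te'.
by rewrite !addrA.
Qed.

Hypothesis hharm : harmonic_section g G sigma.
Hypothesis h1 : forall p, let s := sqnorm g (sigma p) in
  0 <= 2 * hderive B s + s * hderive C s.
Hypothesis h2 : forall p, let s := sqnorm g (sigma p) in
  - B s + s * hderive B s + s ^+ 2 * hderive C s <= 0.

Lemma kk_section_chart (B' C' : R -> R) y :
  (forall t, 0 <= t -> B' t = B t) -> (forall t, 0 <= t -> C' t = C t) ->
  U y -> kk_at gi Hi B' C' (fi y).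
Proof.
move=> eB eC [p dp <-]; rewrite section_chart //.
have := @kk_chart B' C' (sigma p) eB eC; rewrite foot_sigma; exact.
Qed.

Lemma kk_scaled_chart (B' C' : R -> R) y (t : R) :
  (forall t, 0 <= t -> B' t = B t) -> (forall t, 0 <= t -> C' t = C t) ->
  U y -> kk_at gi Hi B' C' (t *: row_mx 0 (si y) + fi y).
Proof.
move=> eB eC [p dp <-]; rewrite field_chart // section_chart //.
have [e fe te] := tangent_scale atlas_of (1 + t) (sigma p).
have := @kk_chart B' C' e eB eC; rewrite fe te foot_sigma => /(_ dp).
by rewrite scale_row_mx add_row_mx scaler0 add0r scalerDl scale1r addrC.
Qed.

(** A vertical vector is orthogonal to the horizontal part of the tension, so pairing with one sees
    exactly the component that harmonicity kills. *)
Lemma harmonic_radial p : dom i p ->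
  form (Hi (fi (coord i p))) (tension_coord gi Hi fi (coord i p))
    (row_mx 0 (si (coord i p))) = 0.
Proof.
move=> dp; have Up : U (coord i p) by exists p.
rewrite (@kk_section_chart B C) // vertical_row0 row_mxKl form0r add0r.
have -> : vertical gi (fi (coord i p)) (tension_coord gi Hi fi (coord i p)) = 0.
  rewrite -(hharm dp) /vpart /vertical /chart_Gamma foot_sigma.
  by rewrite section_chart // row_mxKl row_mxKr.
by rewrite !form0l !mulr0 mul0r addr0.
Qed.

Lemma laplacian_facts p (Q : 'M[R]_n) : let x := coord i p in
  dom i p -> Q \in unitmx -> invmx (gi x) = Q^T *m Q ->
  0 <= frame_laplacian gi fi x Q /\
  (forall u, (forall w, 'D_w Si x = 0) -> frame_laplacian gi fi x Q = 0 ->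
     B (Si x) + Si x * hderive B (Si x) != 0 ->
     vertical gi (fi x) ('D_u fi x) = 0).
Proof.
move=> x dp uQ eQ; have Ux : U x by exists p.
have Sx := sqnorm_chart dp; rewrite -/x in Sx.
have Sx0 : 0 <= Si x by apply: positive_form_ge0; exact: metric_pos.
have [[_ [dB _ _] [dC _ _]] _ [_ posG _ smG] _] := hG.
(* The extensions depend on [p]: each is differentiable at the one value [Si x], which is where the
   chain rule needs it. *)
have [B' eB hB'] := halfline_extension Sx0 (dB _ Sx0).
have [C' eC hC'] := halfline_extension Sx0 (dC _ Sx0).
have Hx : exists2 e : tangent D, dom i (foot e) & Hi (fi x) = G ti e.
  have [|e [de _ _ he]] := @lift_chart (sigma p); first by rewrite foot_sigma.
  by exists e => //; rewrite -he foot_sigma /x section_chart.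
have posH : positive_form (Hi (fi x)).
  by have [e de ->] := Hx => v; exact: posG.
have symH : (Hi (fi x))^T = Hi (fi x).
  by have [e de ->] := Hx; exact: lift_metric_sym.
have [_ [_ _ unitH _]] := orthonormal_frame symH posH.
have diffH : differentiable Hi (fi x).
  have [+ _] := smG ti; move=> /(_ [::] (fi x) isT); apply.
  by exists (sigma p); rewrite /= ?foot_sigma // /x section_chart // foot_sigma.
have [dS ddS] := sqnorm_smooth Ux.
have derS w : derivable ('D_w Si) x w.
  have [] // := @is_derive2_partial R n _ Si x w.
  apply: filterS (open_nbhs_nbhs (conj open_chart_image Ux)) => y Uy.
  by case: (sqnorm_smooth Uy).
have dg y : U y -> differentiable gi y by case/metric_smooth.
have df y : U y -> differentiable fi y by case/section_smooth.
have ddf k : differentiable (partial k fi) x by case: (section_smooth Ux).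
have kk1 y : U y -> kk_at gi Hi B' C' (fi y) by exact: kk_section_chart.
have kk2 t : kk_at gi Hi B' C' (t *: row_mx 0 (si x) + fi x).
  exact: kk_scaled_chart.
split=> [|u dS0 lap0 nz].
  apply: (frame_laplacian_ge0 open_chart_image Ux metric_sym metric_unit dg
    lsubmx_section df ddf dS derS diffH symH unitH kk1 kk2 hB' hC' eQ
    (metric_pos Ux) posH (harmonic_radial dp)).
    by have := h1 p; rewrite -Sx.
  by rewrite -/(Si x) eB //; have := h2 p; rewrite -Sx.
apply: (parallel_of_constant_norm open_chart_image Ux metric_sym metric_unit dg
    lsubmx_section df ddf dS derS diffH symH unitH kk1 kk2 hB' hC' uQ eQ
    (metric_pos Ux) (harmonic_radial dp)) => //.
by rewrite -/(Si x) eB.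
Qed.

(** In coordinates the Laplace-Beltrami operator is [ai^{jk} D_j D_k - D_bi], with drift
    [bi^l = g^{jk} Gamma^l_{jk}]: the shape required by the maximum principle. *)
Let ai y := invmx (gi y).
Let bi y := \sum_j \sum_k ai y j k *: \row_l christoffel gi y j k l.

Lemma laplacian_coord x (Q : 'M[R]_n) : U x -> ai x = Q^T *m Q ->
  \sum_j \sum_k ai x j k *: partial j (partial k Si) x - 'D_(bi x) Si x =
  frame_laplacian gi fi x Q.
Proof.
move=> Ux eQ; have [dS ddS] := sqnorm_smooth Ux.
rewrite /frame_laplacian sumrB /bi !(trace_frame _ eQ); congr (_ - _).
  apply: eq_bigr => k _.
  have [|//|_ ->//] := @is_derive2_partial R n _ Si x (row k Q).
  apply: filterS (open_nbhs_nbhs (conj open_chart_image Ux)) => y Uy.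
  by case: (sqnorm_smooth Uy).
rewrite deriveE // linear_sum; apply: eq_bigr => k _.
by rewrite -Gamma_diag deriveE.
Qed.

Lemma subharmonic_chart x : U x ->
  0 <= \sum_j \sum_k ai x j k *: partial j (partial k Si) x - 'D_(bi x) Si x.
Proof.
move=> Ux; have [Q [uQ _ eQ]] := metric_frame Ux.
rewrite (laplacian_coord Ux eQ); move: Ux eQ => [p dp <-] eQ.
by case: (laplacian_facts dp uQ eQ).
Qed.

Lemma metric_cvg x j k : U x -> gi y j k @[y --> x] --> gi x j k.
Proof.
move=> Ux; have [dg _] := metric_smooth Ux.
exact/differentiable_continuous/differentiable_entry.
Qed.

Lemma inverse_metric_cvg x : U x ->
  forall j k, ai y j k @[y --> x] --> ai x j k.
Proof.
move=> Ux; apply: (@cvg_invmx _ _ (nbhs x)).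
- apply: filterS (open_nbhs_nbhs (conj open_chart_image Ux)) => y.
  exact: metric_unit.
- exact: metric_unit.
- by move=> j k; exact: metric_cvg.
Qed.

Lemma metric_derive_cvg x j k l : U x ->
  partial j (fun y => gi y k l) z @[z --> x] --> partial j (fun y => gi y k l) x.
Proof.
move=> Ux; have e y : U y -> partial j gi y k l = partial j (fun y => gi y k l) y.
  move=> Uy; have [dg _] := metric_smooth Uy.
  by have /is_derive_mxP/(_ k l)[_ /esym] := is_derive_diff (delta_mx 0 j) dg.
rewrite -(e _ Ux).
apply: (@cvg_trans _ (partial j gi y k l @[y --> x])).
  have nU : \forall y \near x, U y.
    exact: (open_nbhs_nbhs (conj open_chart_image Ux)).
  by apply: (@near_eq_cvg _ _ (nbhs x)); apply: filterS nU => y; exact: e.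
have [_ dg] := metric_smooth Ux.
have h : differentiable (fun y => partial j gi y k l) x.
  by apply: differentiable_entry; exact: dg.
exact: (differentiable_continuous h).
Qed.

Lemma christoffel_cvg x j k l : U x ->
  christoffel gi y j k l @[y --> x] --> christoffel gi x j k l.
Proof.
move=> Ux; have d := fun a b c => @metric_derive_cvg x a b c Ux.
apply: (@cvgM R _ (nbhs x)); first exact: (@cvg_cst _ (2^-1 : R) _ (nbhs x)).
apply: (@cvg_sumr _ _ (nbhs x)) => a.
apply: (@cvgM R _ (nbhs x)); first exact: inverse_metric_cvg.
apply: (@cvgB _ _ _ (nbhs x)); last exact: d.
by apply: (@cvgD _ _ _ (nbhs x)); exact: d.
Qed.

Lemma drift_cvg x : U x -> forall l, bi y 0 l @[y --> x] --> bi x 0 l.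
Proof.
move=> Ux l.
have e y : bi y 0 l = \sum_j \sum_k ai y j k * christoffel gi y j k l.
  rewrite summxE; apply: eq_bigr => j _; rewrite summxE.
  by apply: eq_bigr => k _; rewrite !mxE.
rewrite e (_ : (fun y => _) = fun y => \sum_j \sum_k ai y j k * christoffel gi y j k l).
  apply: (@cvg_sumr _ _ (nbhs x)) => j; apply: (@cvg_sumr _ _ (nbhs x)) => k.
  by apply: (@cvgM R _ (nbhs x)); [exact: inverse_metric_cvg|exact: christoffel_cvg].
exact/funext.
Qed.

Lemma sqnorm_max_chart m : (forall p, sqnorm g (sigma p) <= m) ->
  forall p, dom i p -> sqnorm g (sigma p) = m ->
  \forall y \near coord i p, Si y = m.
Proof.
move=> le_m p dp sp; have Up : U (coord i p) by exists p.
apply: (maximum_locally_constant open_chart_image (a := ai) (b := bi)) => //.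
- by move=> x /metric_frame[Q [uQ _ eQ]]; exists Q.
- exact: inverse_metric_cvg.
- exact: drift_cvg.
- by move=> x /sqnorm_smooth[].
- by move=> x /sqnorm_smooth[].
- exact: subharmonic_chart.
- by move=> _ [q dq <-]; rewrite sqnorm_chart.
- by rewrite sqnorm_chart.
Qed.

(** The homeomorphism clause of [smooth_manifold] speaks of open sets, hence the passage to the
    interior of [P]. *)
Lemma chart_nbhs p (P : set 'rV[R]_n) : dom i p -> nbhs (coord i p) P ->
  nbhs p [set q | dom i q /\ P (coord i q)].
Proof.
move=> dp Vp; have oV := @open_interior _ P; have VP := @interior_subset _ P.
have [_ _ _ _ homeo] := hM.
pose O := [set q | dom i q /\ P° (coord i q)].
have oO : open O.
  apply/(homeo i O); first by move=> q [].
  rewrite (_ : _ @` O = U `&` P°); first exact: openI open_chart_image oV.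
  apply/seteqP; split=> [_ [q [dq Vq] <-]|_ [[q dq <-] Vq]].
    by split => //; exists q.
  by exists q.
by apply: filterS (open_nbhs_nbhs (conj oO (conj dp Vp))) => q [dq /VP].
Qed.

Lemma parallel_chart c : (forall p, sqnorm g (sigma p) = c) ->
  B c + c * hderive B c != 0 ->
  forall p u, dom i p -> covariant_derivative g sigma i p u = 0.
Proof.
move=> sc nz p u dp; have Up : U (coord i p) by exists p.
have Sc y : U y -> Si y = c by move=> [q dq <-]; rewrite sqnorm_chart.
have near_c : \forall y \near coord i p, Si y = cst c y.
  by apply: filterS (open_nbhs_nbhs (conj open_chart_image Up)) => y /Sc.
have dS0 w y : U y -> 'D_w Si y = 0.
  move=> Uy; rewrite -(derive_cst c y w); apply: near_eq_derive.
  by apply: filterS (open_nbhs_nbhs (conj open_chart_image Uy)) => z /Sc.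
have [Q [uQ _ eQ]] := metric_frame Up.
have lap0 : frame_laplacian gi fi (coord i p) Q = 0.
  apply: big1 => k _; rewrite [X in _ - X]dS0 // subr0.
  rewrite -[RHS](derive_cst (0 : R) (coord i p) (row k Q)); apply: near_eq_derive.
  by apply: filterS (open_nbhs_nbhs (conj open_chart_image Up)) => z /dS0.
have [_ /(_ u (fun w => dS0 w _ Up) lap0)] := laplacian_facts dp uQ eQ.
rewrite Sc // => /(_ nz); rewrite /vertical /covariant_derivative /chart_Gamma.
rewrite section_chart // row_mxKl row_mxKr => <-; congr (_ + _).
  have [df _] := section_smooth Up.
  case: (is_derive_snd (is_derive_diff u df)) => _ <-.
  apply: near_eq_derive.
  apply: filterS (open_nbhs_nbhs (conj open_chart_image Up)) => _ [q dq <-].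
  by rewrite (read_inE atlas_of) // section_chart // row_mxKr.
congr (Gamma _ _ _ _); apply/esym.
have df y : U y -> differentiable fi y by case/section_smooth.
exact: (lsubmx_derive open_chart_image lsubmx_section df).
Qed.

End InChart.
End HarmonicSection.

(** * From charts to the compact connected manifold *)

Lemma sqnorm_continuous (R : realType) n (M : topologicalType) (D : charts R n M)
    (g : tensor2 D) (sigma : M -> tangent D) :
  smooth_manifold D -> riemannian_metric g -> vector_field sigma ->
  continuous (fun p => sqnorm g (sigma p)).
Proof.
move=> hM hg hs p; have [[cover _ _ _] _ _ _ _] := hM; have [i dp] := cover p.
have [dS _] := sqnorm_smooth hM hg hs (i := i) (ex_intro2 _ _ p dp erefl).
move=> P; rewrite -(sqnorm_chart hM hg hs dp) => NP.
have /(chart_nbhs hM dp) := differentiable_continuous dS NP.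
by apply: filterS => q [dq]; rewrite /= sqnorm_chart.
Qed.

Theorem proposition3p3 (R : realType) (n : nat) (M : topologicalType)
    (D : charts R n M) (hM : smooth_manifold D)
    (hcompact : compact [set: M]) (hconnected : connected [set: M])
    (g : tensor2 D) (hg : riemannian_metric g)
    (A B C : R -> R) (G : tensor2 (tangent_charts D))
    (hG : kaluza_klein g A B C G) (hA : forall t, 0 <= t -> A t = 1)
    (sigma : M -> tangent D) (hsigma : vector_field sigma)
    (hharm : harmonic_section g G sigma)
    (h1 : forall p, let s := sqnorm g (sigma p) in
       0 <= 2 * hderive B s + s * hderive C s)
    (h2 : forall p, let s := sqnorm g (sigma p) in
       - B s + s * hderive B s + s ^+ 2 * hderive C s <= 0) :
  (exists c : R, forall p, tnorm g (sigma p) = c) /\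
  ((forall p, let s := sqnorm g (sigma p) in B s + s * hderive B s != 0) ->
     parallel g sigma).
Proof.
(* The maximum of the norm needs a point; on an empty [M] both claims hold vacuously, with the
   arbitrary constant [0]. *)
have [M0|noM] := pselect ([set: M] !=set0); last first.
  split; first by exists 0 => p; case: noM; exists p.
  by move=> _ i p; case: noM; exists p.
have cont := sqnorm_continuous hM hg hsigma.
have [|p0 _ max0] := compact_EVT_max M0 hcompact (f := fun p => sqnorm g (sigma p)).
  exact: continuous_subspaceT.
pose m := sqnorm g (sigma p0).
have le_m p : sqnorm g (sigma p) <= m by apply: max0; rewrite inE.
(* The set where the maximum is attained is nonempty, open by the strong maximum principle read in
   charts, and closed by continuity; connectedness makes it all of [M]. *)
have const p : sqnorm g (sigma p) = m.
  suff e : [set q | sqnorm g (sigma q) = m] = [set: M].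
    by have : [set: M] p by []; rewrite -e.
  apply: hconnected; first by exists p0.
  - exists [set q | sqnorm g (sigma q) = m]; last by rewrite setTI.
    rewrite openE => q /= sq.
    have [[cover _ _ _] _ _ _ _] := hM; have [i dq] := cover q.
    have := sqnorm_max_chart hM hg hG hA hsigma hharm h1 h2 le_m dq sq.
    move=> /(chart_nbhs hM dq); apply: filterS => r [dr].
    by rewrite /= (sqnorm_chart hM hg hsigma dr).
  - exists [set q | sqnorm g (sigma q) = m]; last by rewrite setTI.
    apply: (preimage_closed (f := fun q => sqnorm g (sigma q)) (D := [set m])).
      by move=> q _; exact: cont.
    exact: closed_eq.
split; first by exists (Num.sqrt m) => p; rewrite /tnorm const.
move=> nz i p u dp.
apply: (parallel_chart hM hg hG hA hsigma hharm h1 h2 const) => //.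
by have := nz p; rewrite /= const.
Qed.
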